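(* Assume that $p,q\in\mathbb{C}$. (i) If $p>0$ and $q>0$, then $$\tilde{I}_{p,q}^{\pm}:=Os\text{-}\int_{0}^{\infty}e^{\pm ix^{p}}x^{q-1}\,dx=p^{-1}e^{\pm i\frac{\pi}{2}\frac{q}{p}}\Gamma\left(\frac{q}{p}\right).$$ (ii) The $\tilde{I}_{p,q}^{\pm}$ can be extended non-zero meromorphic on $\mathbb{C}$ with poles of order $1$ at $q=-pj$ for $j\in\mathbb{N}$ as to $q$ for each $p\in\mathbb{C}\setminus\{0\}$, and meromorphic on $\mathbb{C}\setminus\{0\}$ with poles of order $1$ at $p=-q/j$ for $j\in\mathbb{N}$ as to $p$ for each $q\in\mathbb{C}$. The $\tilde{I}^{\pm}_{p,q}$ are called ''generalized Fresnel integrals''.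
   Context: $\mathbb{N}$ is the set of positive integers. The double signs $\pm$ are in the same order. $\Gamma$ is the Gamma function. $\mathcal{S}(\mathbb{R})$ is the Schwartz space of rapidly decreasing $C^\infty$ functions on $\mathbb{R}$. The oscillatory integral is defined by $$Os\text{-}\int_{0}^{\infty}e^{\pm ix^{p}}x^{q-1}\,dx:=\lim_{\varepsilon\to+0}\int_{0}^{\infty}e^{\pm ix^{p}}x^{q-1}\chi(\varepsilon x)\,dx,$$ whenever this limit of improper integrals exists and is independent of $\chi\in\mathcal{S}(\mathbb{R})$ with $\chi(0)=1$.
   Formalization: The poles in q are taken at q = -pj for all j ≥ 0, not only j ≥ 1, since Γ(q/p) also has a simple pole at q = 0; for q = 0 the extension in p, undetermined by the integral, is only required to be some function holomorphic on C\{0}. *)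

(* Defs.v *)
From Stdlib Require Import Reals.
From Coquelicot Require Import Coquelicot.
Open Scope R_scope.

Definition cexp (z : C) : C :=
  (exp (Re z) * cos (Im z), exp (Re z) * sin (Im z)).

(* Euler's integral; it converges for x > 0, the only range where the value of
   [Gamma] is used. *)
Definition Gamma (x : R) : R :=
  RInt_gen (fun t => exp (- t) * Rpower t (x - 1))
    (at_right 0) (Rbar_locally p_infty).

Definition schwartz_R (f : R -> R) : Prop :=
  (forall (n : nat) (x : R), ex_derive_n f n x) /\
  (forall m n : nat, exists M : R,
     forall x : R, Rabs (x ^ m * Derive_n f n x) <= M).

(* Complex-valued Schwartz functions on the real line. *)
Definition schwartz (chi : R -> C) : Prop :=
  schwartz_R (fun x => Re (chi x)) /\ schwartz_R (fun x => Im (chi x)).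

(* [is_Os_integral s p q l]: with s = 1 or s = -1 standing for the double sign,
   the oscillatory integral of e^{s i x^p} x^{q-1} over (0, +oo) exists and
   equals l.  Requiring the same l for every chi is the independence of chi.
   The integrals are improper both at 0 (singular if q < 1) and at +oo. *)
Definition is_Os_integral (s p q : R) (l : C) : Prop :=
  forall chi : R -> C, schwartz chi -> chi 0 = RtoC 1 ->
  exists J : R -> C,
    (forall eps : R, 0 < eps ->
       is_RInt_gen (V := C_R_NormedModule)
         (fun x : R => (cexp (RtoC s * Ci * RtoC (Rpower x p))
                        * RtoC (Rpower x (q - 1)) * chi (eps * x)%R)%C)
         (at_right 0) (Rbar_locally p_infty) (J eps)) /\
    filterlim J (at_right 0) (locally (T := C_UniformSpace) l).

Definition holomorphic_at (f : C -> C) (z : C) : Prop :=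
  locally (T := C_UniformSpace) z
    (fun w => ex_derive (K := C_AbsRing) (V := C_NormedModule) f w).

(* The value of f at the pole itself is irrelevant. *)
Definition pole_of_order (n : nat) (f : C -> C) (a : C) : Prop :=
  (1 <= n)%nat /\
  exists g : C -> C, holomorphic_at g a /\ g a <> RtoC 0 /\
    locally' (T := C_UniformSpace) a (fun z => f z = (g z / (z - a) ^ n)%C).

Definition meromorphic_on (D : C -> Prop) (f : C -> C) : Prop :=
  forall z : C, D z ->
    holomorphic_at f z \/ exists n : nat, pole_of_order n f z.

(* Main.v *)
Require Import Defs.
From Stdlib Require Import Reals Lra Lia Classical.
From Coquelicot Require Import Coquelicot.
Open Scope R_scope.

(** After the substitution y = x^p the integral becomes that of
    e^{iy} y^{a-1} with a = q/p, regularised by f(eps y^c) with c = 1/p.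
    Repeated integration by parts lowers the exponent a - 1 until everything
    converges absolutely, so the limit as eps -> 0 exists and is f(0) times a
    number that depends neither on f nor on c.  That number is found by taking
    f(t) = e^{-t} and c = 1: the regularised integral is then a Gamma integral
    along a rotated ray, hence equal to that along the positive axis.

    For the continuation, 1/Gamma is the Weierstrass product
    z e^{gamma z} prod (1 + z/n) e^{-z/n}, which is entire with simple zeros at
    0, -1, -2, ...; it agrees with the reciprocal of Euler's integral on x > 0
    because the log-convexity of Gamma gives
    Gamma(n + x) ~ n^x Gamma(n). *)

(** * Improper integrals on the positive half-line *)

(** The limit in eps rests on |f(t) - f(0)| <= M t for t > 0. With t = eps y^c, replacing f by f(0)
    costs c in the exponent: absolute convergence at infinity needs b + c < 0, so the number of
    integrations by parts grows with c. Treating all c below a fixed bound C0 together makes the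
    limiting constant common to them, and it can then be read off at c = 1. All integrals are real.
    A phase th in cos(y + th) carries both parts of e^{iy} and absorbs the quarter turn produced by
    each integration by parts. The ray is rotated by differentiating in the angle, so no contour
    integral occurs. The continuation is p^{-1} e^{+-i pi q/(2p)} divided by the value of the entire
    function 1/Gamma at q/p. Its poles come from the zeros of that function, and their order is read
    from an explicit factorisation. *)

Definition continuous_pos (f : R -> R) : Prop := forall x : R, 0 < x -> continuous f x.

Lemma ex_RInt_continuous_pos (f : R -> R) (a b : R) :
  continuous_pos f -> 0 < a -> 0 < b -> ex_RInt f a b.
Proof.
  intros Hf Ha Hb; apply (ex_RInt_continuous (V := R_CompleteNormedModule)).
  intros z [Hz _]; apply Hf.
  apply Rlt_le_trans with (2 := Hz); apply Rmin_glb_lt; assumption.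
Qed.

Lemma is_RInt_continuous_pos (f : R -> R) (a b : R) :
  continuous_pos f -> 0 < a -> 0 < b -> is_RInt f a b (RInt f a b).
Proof.
  intros Hf Ha Hb; apply (RInt_correct (V := R_CompleteNormedModule)).
  now apply ex_RInt_continuous_pos.
Qed.

(** Continuity on the positive half-line makes [RInt] a true integral as soon as both end points are
    positive. An improper integral can then be handled as a limit of the function [RInt f a b]
    instead of the relation [is_RInt]. *)
Lemma is_RInt_gen_of_filterlim (f : R -> R) (Fa Fb : (R -> Prop) -> Prop) (l : R)
  (FFa : Filter Fa) (FFb : Filter Fb) :
  continuous_pos f -> Fa (fun x => 0 < x) -> Fb (fun x => 0 < x) ->
  filterlim (fun ab => RInt f (fst ab) (snd ab)) (filter_prod Fa Fb) (locally l) ->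
  is_RInt_gen f Fa Fb l.
Proof.
  intros Hf Ha Hb Hl P HP.
  assert (H0 : filter_prod Fa Fb (fun ab => 0 < fst ab /\ 0 < snd ab)).
  { now apply (Filter_prod Fa Fb _ (fun x => 0 < x) (fun x => 0 < x)). }
  assert (H1 : filter_prod Fa Fb (fun ab => P (RInt f (fst ab) (snd ab)))) by exact (Hl P HP).
  refine (filter_imp _ _ _ (filter_and _ _ H1 H0)); intros [a b] [H2 [H3 H4]]; simpl in *.
  exists (RInt f a b); split; [now apply is_RInt_continuous_pos | exact H2].
Qed.

Lemma filterlim_of_is_RInt_gen (f : R -> R) (Fa Fb : (R -> Prop) -> Prop) (l : R)
  (FFa : Filter Fa) (FFb : Filter Fb) :
  is_RInt_gen f Fa Fb l ->
  filterlim (fun ab => RInt f (fst ab) (snd ab)) (filter_prod Fa Fb) (locally l).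
Proof.
  intros Hl P HP.
  unfold is_RInt_gen, filterlimi, filter_le, filtermapi in Hl.
  refine (filter_imp (F := filter_prod Fa Fb) _ _ _ (Hl P HP)); intros [a b] [y [H1 H2]]; simpl in *.
  now rewrite (is_RInt_unique _ _ _ _ H1).
Qed.

(** The absolute value on the right allows [a] and [b] in either order; the Cauchy argument below
    compares end points that are not ordered. *)
Lemma RInt_le_primitive (f g G : R -> R) (a b : R) :
  continuous_pos f -> continuous_pos g ->
  (forall x, 0 < x -> is_derive G x (g x)) ->
  (forall x, 0 < x -> Rabs (f x) <= g x) ->
  0 < a -> 0 < b -> Rabs (RInt f a b) <= Rabs (G b - G a).
Proof.
  intros Hf Hg HG Hfg.
  assert (W : forall a b, 0 < a -> a <= b -> Rabs (RInt f a b) <= Rabs (G b - G a)).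
  { clear a b; intros a b Ha Hab.
    apply Rle_trans with (2 := Rle_abs _).
    assert (H : is_RInt g a b (G b - G a)).
    { apply (is_RInt_derive (V := R_CompleteNormedModule)).
      - intros x [Hx _]; apply HG; rewrite Rmin_left in Hx; lra.
      - intros x [Hx _]; apply Hg; rewrite Rmin_left in Hx; lra. }
    apply (norm_RInt_le (V := R_NormedModule) f g a b); try assumption.
    - intros x Hx; apply Hfg; lra.
    - apply is_RInt_continuous_pos; auto; lra. }
  intros Ha Hb; destruct (Rle_lt_dec a b) as [H|H].
  - now apply W.
  - rewrite <- (opp_RInt_swap (V := R_CompleteNormedModule)).
    2: now apply ex_RInt_continuous_pos.
    change (Rabs (- RInt f b a) <= Rabs (G b - G a)).
    rewrite Rabs_Ropp, Rabs_minus_sym; apply W; lra.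
Qed.

Lemma filterlim_Rplus {T : Type} (F : (T -> Prop) -> Prop) (FF : Filter F) (f g : T -> R) (lf lg : R) :
  filterlim f F (locally lf) -> filterlim g F (locally lg) ->
  filterlim (fun x => f x + g x) F (locally (lf + lg)).
Proof.
  intros Hf Hg; refine (filterlim_comp_2 _ _ _ Hf Hg _).
  apply (filterlim_plus (K := R_AbsRing) (V := R_NormedModule) lf lg).
Qed.

(** Comparison test: increments of the integral of [f] are controlled by those of [G], which has a
    limit at each end, so the Cauchy criterion applies along the product filter. The bound on [l] is
    kept because it later measures the error made by the regularisation. *)
Lemma is_RInt_gen_dominated (f g G : R -> R) (Fa Fb : (R -> Prop) -> Prop) (A B : R)
  (FFa : ProperFilter Fa) (FFb : ProperFilter Fb) :
  continuous_pos f -> continuous_pos g ->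
  (forall x, 0 < x -> is_derive G x (g x)) ->
  (forall x, 0 < x -> Rabs (f x) <= g x) ->
  Fa (fun x => 0 < x) -> Fb (fun x => 0 < x) ->
  filterlim G Fa (locally A) -> filterlim G Fb (locally B) ->
  exists l, is_RInt_gen f Fa Fb l /\ Rabs l <= Rabs (B - A).
Proof.
  intros Hf Hg HG Hfg Pa Pb HA HB.
  assert (E : exists l : R_CompleteSpace,
    filterlim (fun ab => RInt f (fst ab) (snd ab)) (filter_prod Fa Fb) (locally l)).
  { apply (filterlim_locally_cauchy (U := R_CompleteSpace)); intros eps.
    (* At each end two values of [G] lie within [eps / 5] of the limit, so they differ by at most
       [2 * (eps / 5)]; the two ends together stay below [eps]. *)
    assert (He : 0 < eps / 5) by (generalize (cond_pos eps); lra).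
    pose (e := mkposreal _ He).
    exists (fun ab => (0 < fst ab /\ ball A e (G (fst ab))) /\
                      (0 < snd ab /\ ball B e (G (snd ab)))); split.
    - apply (Filter_prod _ _ _ (fun x => 0 < x /\ ball A e (G x)) (fun x => 0 < x /\ ball B e (G x))).
      + apply filter_and; [exact Pa|]. apply HA; apply locally_ball.
      + apply filter_and; [exact Pb|]. apply HB; apply locally_ball.
      + intros x y Hx Hy; split; assumption.
    - intros [a b] [a' b'] [[H1 H2] [H3 H4]] [[H5 H6] [H7 H8]]; simpl in *.
      change (Rabs (RInt f a' b' - RInt f a b) < eps).
      change (Rabs (G a - A) < eps / 5) in H2.
      change (Rabs (G b - B) < eps / 5) in H4.
      change (Rabs (G a' - A) < eps / 5) in H6.
      change (Rabs (G b' - B) < eps / 5) in H8.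
      generalize (RInt_Chasles (V := R_CompleteNormedModule) f a' a b'
        (ex_RInt_continuous_pos f _ _ Hf H5 H1) (ex_RInt_continuous_pos f _ _ Hf H1 H7)).
      generalize (RInt_Chasles (V := R_CompleteNormedModule) f a b b'
        (ex_RInt_continuous_pos f _ _ Hf H1 H3) (ex_RInt_continuous_pos f _ _ Hf H3 H7)).
      unfold plus; simpl; intros E1 E2; rewrite <- E2, <- E1.
      generalize (RInt_le_primitive f g G a' a Hf Hg HG Hfg H5 H1).
      generalize (RInt_le_primitive f g G b b' Hf Hg HG Hfg H3 H7).
      generalize dependent (RInt f a' a); generalize dependent (RInt f b b').
      intros u _ v _ Hu Hv.
      replace (v + (RInt f a b + u) - RInt f a b) with (v + u) by ring.
      assert (Rabs (G a - G a') <= 2 * (eps / 5)).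
      { replace (G a - G a') with ((G a - A) - (G a' - A)) by ring.
        apply Rle_trans with (1 := Rabs_triang _ _); rewrite Rabs_Ropp; lra. }
      assert (Rabs (G b' - G b) <= 2 * (eps / 5)).
      { replace (G b' - G b) with ((G b' - B) - (G b - B)) by ring.
        apply Rle_trans with (1 := Rabs_triang _ _); rewrite Rabs_Ropp; lra. }
      apply Rle_lt_trans with (1 := Rabs_triang _ _); generalize (cond_pos eps); lra. }
  destruct E as [l Hl]; exists l; split.
  - apply is_RInt_gen_of_filterlim; try assumption; apply _.
  - assert (H1 : filterlim (fun ab : R * R => Rabs (RInt f (fst ab) (snd ab)))
       (filter_prod Fa Fb) (locally (Rabs l))).
    { apply filterlim_comp with (1 := Hl). apply (continuous_Rabs l). }
    assert (H2 : filterlim (fun ab : R * R => Rabs (G (snd ab) - G (fst ab)))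
       (filter_prod Fa Fb) (locally (Rabs (B - A)))).
    { apply filterlim_comp with (2 := continuous_Rabs (B - A)).
      apply (filterlim_Rplus _ _ (fun ab : R * R => G (snd ab)) (fun ab : R * R => - G (fst ab))).
      - apply filterlim_comp with (2 := HB). apply filterlim_snd.
      - apply filterlim_comp with (G := locally A).
        + apply filterlim_comp with (2 := HA). apply filterlim_fst.
        + apply (filterlim_opp (K := R_AbsRing) (V := R_NormedModule) A). }
    refine (filterlim_le (F := filter_prod Fa Fb) _ _ (Finite (Rabs l)) (Finite (Rabs (B - A))) _ H1 H2).
    apply (Filter_prod _ _ _ (fun x => 0 < x) (fun x => 0 < x)); try assumption.
    intros x y Hx Hy; simpl; apply (RInt_le_primitive f g G); assumption.
Qed.

Lemma is_RInt_gen_primitive (f F : R -> R) (Fa Fb : (R -> Prop) -> Prop) (A B : R)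
  (FFa : Filter Fa) (FFb : Filter Fb) :
  continuous_pos f ->
  (forall x, 0 < x -> is_derive F x (f x)) ->
  Fa (fun x => 0 < x) -> Fb (fun x => 0 < x) ->
  filterlim F Fa (locally A) -> filterlim F Fb (locally B) ->
  is_RInt_gen f Fa Fb (B - A).
Proof.
  intros Hf HF Pa Pb HA HB.
  apply is_RInt_gen_of_filterlim; try assumption.
  apply filterlim_ext_loc with (fun ab : R * R => F (snd ab) - F (fst ab)).
  - apply (Filter_prod _ _ _ (fun x => 0 < x) (fun x => 0 < x)); try assumption.
    intros a b Ha Hb; simpl; symmetry.
    apply (is_RInt_unique (V := R_CompleteNormedModule)).
    apply (is_RInt_derive (V := R_CompleteNormedModule)).
    + intros x [Hx _]; apply HF; apply Rlt_le_trans with (2 := Hx); now apply Rmin_glb_lt.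
    + intros x [Hx _]; apply Hf; apply Rlt_le_trans with (2 := Hx); now apply Rmin_glb_lt.
  - apply (filterlim_Rplus _ _ (fun ab : R * R => F (snd ab)) (fun ab : R * R => - F (fst ab))).
    + apply filterlim_comp with (2 := HB). apply filterlim_snd.
    + apply filterlim_comp with (G := locally A).
      * apply filterlim_comp with (2 := HA). apply filterlim_fst.
      * apply (filterlim_opp (K := R_AbsRing) (V := R_NormedModule) A).
Qed.

(** * Powers, their limits at 0 and at infinity, and comparison with them *)

Lemma exp_le_compat (x y : R) : x <= y -> exp x <= exp y.
Proof. intros [H|<-]; [now apply Rlt_le, exp_increasing | apply Rle_refl]. Qed.

Lemma Rpower_pos (x y : R) : 0 < Rpower x y.
Proof. apply exp_pos. Qed.

Lemma is_derive_Rpower (r x : R) :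
  0 < x -> is_derive (fun y => Rpower y r) x (r * Rpower x (r - 1)).
Proof.
  intros Hx; unfold Rpower; auto_derive; [exact Hx|].
  replace ((r - 1) * ln x) with (r * ln x - ln x) by ring.
  unfold Rminus; rewrite exp_plus, exp_Ropp, exp_ln by exact Hx; field; lra.
Qed.

Lemma at_right_pos : at_right 0 (fun x => 0 < x).
Proof. exists (mkposreal 1 Rlt_0_1); intros y _ Hy; exact Hy. Qed.

Lemma p_infty_pos : Rbar_locally p_infty (fun x => 0 < x).
Proof. exists 0; auto. Qed.

Lemma filterlim_Rpower_p_infty (r : R) :
  0 < r -> filterlim (fun x => Rpower x r) (Rbar_locally p_infty) (Rbar_locally p_infty).
Proof.
  intros Hr.
  apply filterlim_comp with (2 := is_lim_exp_p).
  apply filterlim_comp with (1 := is_lim_ln_p).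
  intros P [M HM]; exists (M / r); intros x Hx; apply HM.
  apply Rmult_lt_reg_r with (/ r); [now apply Rinv_0_lt_compat|].
  replace (r * x * / r) with x by (field; lra); exact Hx.
Qed.

Lemma Rpower_Rinv_base (x r : R) : 0 < x -> Rpower (/ x) r = Rpower x (- r).
Proof. intros Hx; unfold Rpower; rewrite ln_Rinv by exact Hx; f_equal; ring. Qed.

Lemma filterlim_Rpower_at_right (r : R) :
  0 < r -> filterlim (fun x => Rpower x r) (at_right 0) (at_right 0).
Proof.
  intros Hr.
  apply filterlim_ext_loc with (fun x => / Rpower (/ x) r).
  - exists (mkposreal 1 Rlt_0_1); intros y _ Hy.
    rewrite Rpower_Rinv_base by exact Hy; rewrite Rpower_Ropp, Rinv_inv; reflexivity.
  - apply filterlim_comp with (Rbar_locally p_infty).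
    + apply (filterlim_comp _ _ _ Rinv (fun x => Rpower x r) _ _ _ filterlim_Rinv_0_right).
      now apply filterlim_Rpower_p_infty.
    + intros P [e He].
      exists (/ e); intros x Hx.
      assert (Hx0 : 0 < x) by (apply Rlt_trans with (2 := Hx); apply Rinv_0_lt_compat, cond_pos).
      apply He; [|now apply Rinv_0_lt_compat].
      change (Rabs (/ x - 0) < e).
      rewrite Rminus_0_r, Rabs_right by (apply Rle_ge, Rlt_le, Rinv_0_lt_compat, Hx0).
      rewrite <- (Rinv_inv e); apply Rinv_lt_contravar; [|exact Hx].
      apply Rmult_lt_0_compat; [apply Rinv_0_lt_compat, cond_pos | exact Hx0].
Qed.

Lemma filterlim_at_right_locally : filterlim (fun x : R => x) (at_right 0) (locally 0).
Proof. intros P [e He]; exists e; intros y Hy _; now apply He. Qed.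

Lemma filterlim_Rpower_0 (r : R) :
  0 < r -> filterlim (fun x => Rpower x r) (at_right 0) (locally 0).
Proof.
  intros Hr.
  exact (filterlim_comp _ _ _ _ (fun x => x) _ _ _
    (filterlim_Rpower_at_right r Hr) filterlim_at_right_locally).
Qed.

Lemma filterlim_Rpower_neg_p_infty (r : R) :
  r < 0 -> filterlim (fun x => Rpower x r) (Rbar_locally p_infty) (locally 0).
Proof.
  intros Hr.
  apply filterlim_ext with (fun x => / Rpower x (- r)).
  - intros x; rewrite Rpower_Ropp; apply Rinv_inv.
  - apply filterlim_comp with (Rbar_locally p_infty).
    + apply filterlim_Rpower_p_infty; lra.
    + apply (filterlim_Rbar_inv p_infty); discriminate.
Qed.

Lemma Rpower_1_l (r : R) : Rpower 1 r = 1.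
Proof. unfold Rpower; now rewrite ln_1, Rmult_0_r, exp_0. Qed.

Lemma filterlim_at_point (f : R -> R) (a l : R) :
  f a = l -> filterlim f (at_point a) (locally l).
Proof. intros <- P HP; exact (locally_singleton _ _ HP). Qed.

Lemma filterlim_mult_const {T : Type} (F : (T -> Prop) -> Prop) (FF : Filter F) (f : T -> R) (k l l' : R) :
  filterlim f F (locally l) -> k * l = l' -> filterlim (fun x => k * f x) F (locally l').
Proof.
  intros Hf <-; refine (filterlim_comp _ _ _ _ (fun y => k * y) _ _ _ Hf _).
  apply (filterlim_scal_r (K := R_AbsRing) (V := R_NormedModule) k l).
Qed.

Lemma continuous_pos_Rpower (r : R) : continuous_pos (fun x => Rpower x r).
Proof.
  intros x Hx; apply (ex_derive_continuous (K := R_AbsRing) (V := R_NormedModule)).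
  exists (r * Rpower x (r - 1)); now apply is_derive_Rpower.
Qed.

Lemma continuous_pos_mult (f g : R -> R) :
  continuous_pos f -> continuous_pos g -> continuous_pos (fun x => f x * g x).
Proof.
  intros Hf Hg x Hx; apply (continuous_mult (K := R_AbsRing)); auto.
Qed.

Lemma is_derive_Rpower_primitive (M r x : R) :
  r <> 0 -> 0 < x ->
  is_derive (fun y => M / r * Rpower y r) x (M * Rpower x (r - 1)).
Proof.
  intros Hr Hx.
  replace (M * Rpower x (r - 1)) with (M / r * (r * Rpower x (r - 1))) by (field; exact Hr).
  apply (is_derive_scal (fun y => Rpower y r)); now apply is_derive_Rpower.
Qed.

(** The bound on [l] is linear in [M], so an integrand of size eps times a power has an integral of
    size eps. *)
Lemma is_RInt_gen_power_0 (f : R -> R) (M r : R) :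
  0 < r -> continuous_pos f -> (forall y, 0 < y -> Rabs (f y) <= M * Rpower y (r - 1)) ->
  exists l, is_RInt_gen f (at_right 0) (at_point 1) l /\ Rabs l <= Rabs (M / r).
Proof.
  intros Hr Hf HM.
  destruct (is_RInt_gen_dominated f (fun y => M * Rpower y (r - 1))
     (fun y => M / r * Rpower y r) (at_right 0) (at_point 1) 0 (M / r)) as [l [H1 H2]];
    try assumption; try apply _.
  - apply continuous_pos_mult; [intros x _; apply continuous_const | apply continuous_pos_Rpower].
  - intros x Hx; apply is_derive_Rpower_primitive; lra.
  - apply at_right_pos.
  - unfold at_point; lra.
  - apply filterlim_mult_const with 0; [apply _ | now apply filterlim_Rpower_0 | ring].
  - apply filterlim_at_point; rewrite Rpower_1_l; ring.
  - exists l; split; [exact H1|]. now rewrite Rminus_0_r in H2.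
Qed.

Lemma is_RInt_gen_power_infty (f : R -> R) (M r : R) :
  r < 0 -> continuous_pos f -> (forall y, 0 < y -> Rabs (f y) <= M * Rpower y (r - 1)) ->
  exists l, is_RInt_gen f (at_point 1) (Rbar_locally p_infty) l /\ Rabs l <= Rabs (M / r).
Proof.
  intros Hr Hf HM.
  destruct (is_RInt_gen_dominated f (fun y => M * Rpower y (r - 1))
     (fun y => M / r * Rpower y r) (at_point 1) (Rbar_locally p_infty) (M / r) 0) as [l [H1 H2]];
    try assumption; try apply _.
  - apply continuous_pos_mult; [intros x _; apply continuous_const | apply continuous_pos_Rpower].
  - intros x Hx; apply is_derive_Rpower_primitive; lra.
  - unfold at_point; lra.
  - apply p_infty_pos.
  - apply filterlim_at_point; rewrite Rpower_1_l; ring.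
  - apply filterlim_mult_const with 0; [apply _ | now apply filterlim_Rpower_neg_p_infty | ring].
  - exists l; split; [exact H1|].
    replace (0 - M / r) with (- (M / r)) in H2 by ring; now rewrite Rabs_Ropp in H2.
Qed.

Lemma filterlim_squeeze_0 {T : Type} (F : (T -> Prop) -> Prop) (FF : Filter F) (f g : T -> R) :
  F (fun x => Rabs (f x) <= g x) -> filterlim g F (locally 0) -> filterlim f F (locally 0).
Proof.
  intros Hfg Hg; apply filterlim_locally; intros e.
  assert (Hg' := proj1 (filterlim_locally g 0) Hg e).
  refine (filter_imp _ _ _ (filter_and _ _ Hfg Hg')); intros x [H1 H2].
  change (Rabs (g x - 0) < e) in H2; change (Rabs (f x - 0) < e).
  rewrite Rminus_0_r in *; apply Rle_lt_trans with (1 := H1).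
  now apply Rle_lt_trans with (1 := Rle_abs _).
Qed.

(** * Regularised oscillatory integrals *)

(** Decay is required only for positive arguments, so that e^{-t}, which is not a Schwartz function,
    can serve as the test function that identifies the limit. Smoothness on the whole line gives the
    behaviour at 0. *)
Definition half_schwartz (f : R -> R) : Prop :=
  (forall (n : nat) (x : R), ex_derive_n f n x) /\
  (forall m n : nat, exists M : R,
     forall x : R, 0 < x -> Rabs (x ^ m * Derive_n f n x) <= M).

(** The y-derivative of f(eps y^c) is c y^{-1} times [euler_op f] at eps y^c. No stray power of eps
    appears, so repeated integration by parts stays within one family of integrands. *)
Definition euler_op (f : R -> R) : R -> R := fun t => t * Derive f t.

Lemma schwartz_R_half_schwartz (f : R -> R) : schwartz_R f -> half_schwartz f.
Proof.
  intros [H1 H2]; split; [exact H1|].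
  intros m n; destruct (H2 m n) as [M HM]; exists M; auto.
Qed.

Lemma Derive_n_euler_op (f : R -> R) (n : nat) :
  (forall (n : nat) (x : R), ex_derive_n f n x) ->
  forall t, Derive_n (euler_op f) n t = t * Derive_n f (S n) t + INR n * Derive_n f n t.
Proof.
  intros Hf; induction n as [|n IH]; intros t.
  - change (t * Derive f t = t * Derive f t + 0 * f t); ring.
  - change (Derive (Derive_n (euler_op f) n) t = t * Derive (Derive_n f (S n)) t + INR (S n) * Derive_n f (S n) t).
    rewrite (Derive_ext _ _ _ IH), S_INR.
    apply is_derive_unique.
    assert (H1 := Derive_correct _ _ (Hf (S n) t)).
    assert (H2 := Derive_correct _ _ (Hf (S (S n)) t)).
    auto_derive; [repeat split; eexists; eassumption|].
    change (Derive (fun x => Derive (Derive_n f n) x) t) with (Derive (Derive_n f (S n)) t).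
    change (Derive (fun x => Derive_n f n x) t) with (Derive_n f (S n) t).
    simpl; ring.
Qed.

Lemma half_schwartz_euler_op (f : R -> R) : half_schwartz f -> half_schwartz (euler_op f).
Proof.
  intros [H1 H2]; split.
  - intros [|n] x; [exact I|].
    change (ex_derive (Derive_n (euler_op f) n) x).
    apply ex_derive_ext with (fun t => t * Derive_n f (S n) t + INR n * Derive_n f n t).
    + intros t; symmetry; now apply Derive_n_euler_op.
    + assert (E1 := H1 (S n) x); assert (E2 := H1 (S (S n)) x).
      auto_derive; repeat split; assumption.
  - intros m n; destruct (H2 (S m) (S n)) as [M HM]; destruct (H2 m n) as [M' HM'].
    exists (M + INR n * M'); intros x Hx.
    rewrite Derive_n_euler_op by exact H1.
    replace (x ^ m * (x * Derive_n f (S n) x + INR n * Derive_n f n x))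
      with (x ^ (S m) * Derive_n f (S n) x + INR n * (x ^ m * Derive_n f n x)) by (simpl; ring).
    apply Rle_trans with (1 := Rabs_triang _ _); apply Rplus_le_compat; [now apply HM|].
    rewrite Rabs_mult, (Rabs_right (INR n)) by (apply Rle_ge, pos_INR).
    apply Rmult_le_compat_l; [apply pos_INR | now apply HM'].
Qed.

Lemma half_schwartz_lipschitz_0 (f : R -> R) :
  half_schwartz f -> exists M, 0 <= M /\ forall t, 0 < t -> Rabs (f t - f 0) <= M * t.
Proof.
  intros [H1 H2]; destruct (H2 O 1%nat) as [M HM].
  assert (HM0 : 0 <= M) by (apply Rle_trans with (1 := Rabs_pos _) (2 := HM 1 Rlt_0_1)).
  exists M; split; [exact HM0|]; intros t Ht.
  destruct (MVT_gen f 0 t (Derive f)) as [c [Hc E]].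
  - intros x _; apply Derive_correct, (H1 1%nat).
  - intros x _; apply continuity_pt_filterlim.
    apply (ex_derive_continuous (K := R_AbsRing) (V := R_NormedModule)), (H1 1%nat).
  - rewrite E, Rminus_0_r, Rabs_mult, (Rabs_right t) by lra.
    apply Rmult_le_compat_r; [lra|].
    rewrite Rmin_left, Rmax_right in Hc by lra.
    destruct (Rle_lt_or_eq_dec 0 c) as [Hc0|<-]; [lra| |].
    + generalize (HM c Hc0); simpl; now rewrite Rmult_1_l.
    + (* At the endpoint 0 the bound follows by continuity of the derivative. *)
      assert (C : continuous (Derive f) 0).
      { apply (ex_derive_continuous (K := R_AbsRing) (V := R_NormedModule)), (H1 2%nat). }
      assert (C' : filterlim (fun x => Rabs (Derive f x)) (at_right 0) (locally (Rabs (Derive f 0)))).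
      { refine (filterlim_comp _ _ _ _ Rabs _ _ _ _ (continuous_Rabs _)).
        exact (filterlim_comp _ _ _ (fun x => x) _ _ _ _ filterlim_at_right_locally C). }
      refine (filterlim_le (F := at_right 0) _ _ (Finite (Rabs (Derive f 0))) (Finite M) _ C' (filterlim_const M)).
      exists (mkposreal 1 Rlt_0_1); intros y _ Hy.
      generalize (HM y Hy); simpl; now rewrite Rmult_1_l.
Qed.

Lemma half_schwartz_continuous (f : R -> R) (x : R) : half_schwartz f -> continuous f x.
Proof.
  intros [H1 _].
  apply (ex_derive_continuous (K := R_AbsRing) (V := R_NormedModule)), (H1 1%nat).
Qed.

(** Up to the factor 1/p this is the integrand after y = x^p, with b = q/p and c = 1/p. The phase
    [th] is 0 for the real part of e^{iy} and [- (PI / 2)] for the imaginary part. *)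
Definition osc_integrand (b c th : R) (f : R -> R) (eps y : R) : R :=
  cos (y + th) * Rpower y (b - 1) * f (eps * Rpower y c).

Lemma continuous_pos_osc (b c th : R) (f : R -> R) (eps : R) :
  half_schwartz f -> continuous_pos (osc_integrand b c th f eps).
Proof.
  intros Hf x Hx; unfold osc_integrand.
  apply (ex_derive_continuous (K := R_AbsRing) (V := R_NormedModule)).
  assert (E := proj1 Hf 1%nat); unfold Rpower.
  auto_derive; repeat split; try assumption; apply E.
Qed.

Lemma osc_integrand_minus_const (b c th : R) (f : R -> R) (eps y : R) :
  osc_integrand b c th f eps y =
  f 0 * (cos (y + th) * Rpower y (b - 1)) +
  cos (y + th) * Rpower y (b - 1) * (f (eps * Rpower y c) - f 0).
Proof. unfold osc_integrand; ring. Qed.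

Lemma Rabs_cos_le (x : R) : Rabs (cos x) <= 1.
Proof. apply Rabs_le, COS_bound. Qed.

(* Both ends of the improper integral are treated by the same argument: it only
   needs that functions O(y^(b-1)) and O(y^(b+c-1)) are integrable between the
   filters Fa and Fb. *)
Lemma osc_dominated (Fa Fb : (R -> Prop) -> Prop) (FFa : ProperFilter Fa) (FFb : ProperFilter Fb)
  (b c th : R) (f : R -> R) (L : R) :
  (forall r h M, r = b + c -> continuous_pos h ->
     (forall y, 0 < y -> Rabs (h y) <= M * Rpower y (r - 1)) ->
     exists l, is_RInt_gen h Fa Fb l /\ Rabs l <= Rabs (M / r)) ->
  is_RInt_gen (fun y => cos (y + th) * Rpower y (b - 1)) Fa Fb L ->
  half_schwartz f ->
  exists I : R -> R,
    (forall eps, 0 < eps -> is_RInt_gen (osc_integrand b c th f eps) Fa Fb (I eps)) /\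
    filterlim I (at_right 0) (locally (L * f 0)).
Proof.
  intros Hdom HL Hf.
  (* Replacing f(eps y^c) by f(0) leaves a remainder [h] of size eps y^(b+c-1). Its integral is
     O(eps) and disappears in the limit, which leaves f(0) times [L]. *)
  destruct (half_schwartz_lipschitz_0 f Hf) as [M [HM0 HM]].
  pose (h := fun eps y => cos (y + th) * Rpower y (b - 1) * (f (eps * Rpower y c) - f 0)).
  assert (Hh : forall eps, 0 < eps -> exists l, is_RInt_gen (h eps) Fa Fb l /\ Rabs l <= Rabs (M / (b + c)) * eps).
  { intros eps He; destruct (Hdom (b + c) (h eps) (M * eps)) as [l [H1 H2]]; auto.
    - intros x Hx; unfold h.
      apply (ex_derive_continuous (K := R_AbsRing) (V := R_NormedModule)).
      assert (E := proj1 Hf 1%nat); unfold Rpower.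
      auto_derive; repeat split; try assumption; apply E.
    - intros y Hy; unfold h; rewrite !Rabs_mult.
      rewrite (Rabs_right (Rpower y (b - 1))) by (apply Rle_ge, Rlt_le, Rpower_pos).
      replace (b + c - 1) with ((b - 1) + c) by ring; rewrite Rpower_plus.
      apply Rle_trans with (1 * Rpower y (b - 1) * (M * (eps * Rpower y c))); [|right; ring].
      apply Rmult_le_compat; try apply Rabs_pos.
      + apply Rmult_le_pos; [apply Rabs_pos | apply Rlt_le, Rpower_pos].
      + apply Rmult_le_compat_r; [apply Rlt_le, Rpower_pos | apply Rabs_cos_le].
      + apply HM, Rmult_lt_0_compat; [exact He | apply Rpower_pos].
    - exists l; split; [exact H1|]. apply Rle_trans with (1 := H2); right.
      replace (M * eps / (b + c)) with (M / (b + c) * eps) by (unfold Rdiv; ring).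
      rewrite Rabs_mult, (Rabs_right eps) by lra; reflexivity. }
  exists (fun eps => L * f 0 + RInt_gen (h eps) Fa Fb); split.
  - intros eps He; destruct (Hh eps He) as [l [H1 _]].
    rewrite (is_RInt_gen_unique (V := R_CompleteNormedModule) _ _ H1).
    apply is_RInt_gen_ext with (fun y => plus (scal (f 0) (cos (y + th) * Rpower y (b - 1))) (h eps y)).
    + apply filter_forall; intros ab x _; symmetry; exact (osc_integrand_minus_const b c th f eps x).
    + apply (is_RInt_gen_plus (V := R_NormedModule)); [|exact H1].
      rewrite Rmult_comm.
      now apply (is_RInt_gen_scal (V := R_NormedModule) _ (f 0) L).
  - apply filterlim_locally; intros e.
    pose (K := Rabs (M / (b + c)) + 1).
    assert (HK : 0 < K) by (unfold K; generalize (Rabs_pos (M / (b + c))); lra).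
    assert (Hd : 0 < e / K) by (apply Rdiv_lt_0_compat; [apply cond_pos | exact HK]).
    exists (mkposreal _ Hd); intros eps Heps He.
    change R in eps; change (Rabs (eps - 0) < e / K) in Heps; rewrite Rminus_0_r, Rabs_right in Heps by lra.
    destruct (Hh eps He) as [l [H1 H2]].
    rewrite (is_RInt_gen_unique (V := R_CompleteNormedModule) _ _ H1).
    change R in l; change (Rabs (L * f 0 + l - L * f 0) < e).
    replace (L * f 0 + l - L * f 0) with (l : R) by (simpl; ring).
    apply Rle_lt_trans with (1 := H2).
    apply Rle_lt_trans with (K * eps); [apply Rmult_le_compat_r; unfold K; lra|].
    apply Rmult_lt_reg_r with (/ K); [now apply Rinv_0_lt_compat|].
    replace (K * eps * / K) with eps by (field; lra); exact Heps.
Qed.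

(** The primitive sin(y + th) of cos(y + th) is again a cosine, with phase [th - PI / 2].
    Differentiating either y^(b-1) or f(eps y^c) costs a factor 1/y, hence the exponent [b - 1] in
    the other two terms. *)
Lemma is_derive_osc (b c th : R) (f : R -> R) (eps y : R) :
  half_schwartz f -> 0 < y ->
  is_derive (osc_integrand b c (th - PI / 2) f eps) y
    (osc_integrand b c th f eps y
     + (b - 1) * osc_integrand (b - 1) c (th - PI / 2) f eps y
     + c * osc_integrand (b - 1) c (th - PI / 2) (euler_op f) eps y).
Proof.
  intros Hf Hy; unfold osc_integrand, Rpower.
  assert (E := proj1 Hf 1%nat).
  auto_derive; [repeat split; try assumption; apply E|].
  unfold euler_op.
  assert (E1 : cos (y + (th - PI / 2)) = sin (y + th)).
  { replace (y + (th - PI / 2)) with ((y + th) - PI / 2) by ring.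
    rewrite cos_minus, sin_PI2, cos_PI2; ring. }
  assert (E2 : sin (y + (th - PI / 2)) = - cos (y + th)).
  { replace (y + (th - PI / 2)) with ((y + th) - PI / 2) by ring.
    rewrite sin_minus, sin_PI2, cos_PI2; ring. }
  assert (E3 : exp ((b - 1 - 1) * ln y) = exp ((b - 1) * ln y) / y).
  { replace ((b - 1 - 1) * ln y) with ((b - 1) * ln y + - ln y) by ring.
    rewrite exp_plus, exp_Ropp, exp_ln by exact Hy; reflexivity. }
  rewrite E1, E2, E3.
  change (Derive (fun x => f x)) with (Derive f).
  field; lra.
Qed.

(** For fixed eps, the decay of f like t^{-m} at t = eps y^c beats y^(b-1) once m > (b-1)/c. *)
Lemma osc_integrand_limit_infty (b c th : R) (f : R -> R) (eps : R) :
  half_schwartz f -> 0 < c -> 0 < eps ->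
  filterlim (osc_integrand b c th f eps) (Rbar_locally p_infty) (locally 0).
Proof.
  intros Hf Hc He.
  destruct (INR_unbounded ((b - 1) / c)) as [m Hm].
  destruct (proj2 Hf m O) as [M HM]; simpl in HM.
  assert (Hr : b - 1 - c * INR m < 0).
  { apply Rmult_gt_compat_r with (r := c) in Hm; [|exact Hc].
    unfold Rdiv in Hm; rewrite Rmult_assoc, Rinv_l in Hm; lra. }
  pose (K := M * / eps ^ m).
  assert (B : forall y, 0 < y -> Rabs (osc_integrand b c th f eps y) <= K * Rpower y (b - 1 - c * INR m)).
  { intros y Hy; unfold osc_integrand; rewrite !Rabs_mult.
    rewrite (Rabs_right (Rpower y (b - 1))) by (apply Rle_ge, Rlt_le, Rpower_pos).
    assert (Ht : 0 < eps * Rpower y c) by (apply Rmult_lt_0_compat; [exact He | apply Rpower_pos]).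
    assert (Hp : 0 < (eps * Rpower y c) ^ m) by now apply pow_lt.
    generalize (HM _ Ht); rewrite Rabs_mult, Rabs_right by lra; intros HB.
    assert (E : Rpower y (b - 1 - c * INR m) = Rpower y (b - 1) * / (Rpower y c) ^ m).
    { unfold Rminus at 1; rewrite Rpower_plus, Rpower_Ropp, <- Rpower_mult, Rpower_pow by apply Rpower_pos.
      reflexivity. }
    rewrite E; unfold K.
    rewrite Rpow_mult_distr in HB, Hp.
    assert (H1 : 0 < eps ^ m) by now apply pow_lt.
    assert (H2 : 0 < Rpower y c ^ m) by apply pow_lt, Rpower_pos.
    replace (M * / eps ^ m * (Rpower y (b - 1) * / Rpower y c ^ m))
      with (1 * Rpower y (b - 1) * (M * / (eps ^ m * Rpower y c ^ m))) by (field; split; apply Rgt_not_eq; assumption).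
    apply Rmult_le_compat; try apply Rabs_pos.
    - apply Rmult_le_pos; [apply Rabs_pos | apply Rlt_le, Rpower_pos].
    - apply Rmult_le_compat_r; [apply Rlt_le, Rpower_pos | apply Rabs_cos_le].
    - apply Rmult_le_reg_l with (1 := Hp).
      replace (eps ^ m * Rpower y c ^ m * (M * / (eps ^ m * Rpower y c ^ m))) with M; [exact HB|].
      field; split; apply Rgt_not_eq; assumption. }
  assert (L : filterlim (fun y => K * Rpower y (b - 1 - c * INR m)) (Rbar_locally p_infty) (locally 0)).
  { apply filterlim_mult_const with 0; [apply _ | now apply filterlim_Rpower_neg_p_infty | ring]. }
  refine (filterlim_squeeze_0 _ _ _ _ _ L).
  exists 0; exact B.
Qed.

(* One integration by parts trades the exponent [b] for [b - 1], at the price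
   of the Euler derivative of [f], which vanishes at 0 and so does not
   contribute to the limit. *)
Lemma osc_tail (C0 : R) (HC0 : 0 < C0) (n : nat) : forall b th, b + C0 < INR n ->
  exists L : R, forall c f, 0 < c <= C0 -> half_schwartz f ->
  exists I : R -> R,
    (forall eps, 0 < eps ->
       is_RInt_gen (osc_integrand b c th f eps) (at_point 1) (Rbar_locally p_infty) (I eps)) /\
    filterlim I (at_right 0) (locally (L * f 0)).
Proof.
  induction n as [|n IH]; intros b th Hb.
  (* Here b + C0 < 0, hence b < 0 and b + c < 0: the limiting integrand and the remainder are both
     absolutely integrable at infinity. *)
  - simpl in Hb.
    destruct (is_RInt_gen_power_infty (fun y => cos (y + th) * Rpower y (b - 1)) 1 b) as [L [HL _]].
    + lra.
    + apply continuous_pos_mult; [|apply continuous_pos_Rpower].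
      intros x _; apply (ex_derive_continuous (K := R_AbsRing) (V := R_NormedModule)).
      auto_derive; exact I.
    + intros y Hy; rewrite Rabs_mult, (Rabs_right (Rpower y (b - 1))) by (apply Rle_ge, Rlt_le, Rpower_pos).
      apply Rmult_le_compat_r; [apply Rlt_le, Rpower_pos | apply Rabs_cos_le].
    + exists L; intros c f Hc Hf.
      apply osc_dominated; try apply _; try assumption.
      intros r h M -> Hh HM; apply is_RInt_gen_power_infty; try assumption; lra.
  - rewrite S_INR in Hb.
    destruct (IH (b - 1) (th - PI / 2)) as [L HL]; [lra|].
    (* The first term is the boundary value at y = 1 as eps tends to 0, the second comes from the
       derivative of y^(b-1). The third integral contributes 0 because [euler_op f 0] is 0, which is
       why c does not enter. *)
    exists (- cos (1 + (th - PI / 2)) - (b - 1) * L); intros c f Hc Hf.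
    destruct (HL c f Hc Hf) as [I1 [H1 H1']].
    destruct (HL c (euler_op f) Hc (half_schwartz_euler_op f Hf)) as [I2 [H2 H2']].
    exists (fun eps => (0 - osc_integrand b c (th - PI / 2) f eps 1) - (b - 1) * I1 eps - c * I2 eps); split.
    + intros eps He.
      apply is_RInt_gen_ext with (fun y => minus (minus
        (osc_integrand b c th f eps y
         + (b - 1) * osc_integrand (b - 1) c (th - PI / 2) f eps y
         + c * osc_integrand (b - 1) c (th - PI / 2) (euler_op f) eps y)
        (scal (b - 1) (osc_integrand (b - 1) c (th - PI / 2) f eps y)))
        (scal c (osc_integrand (b - 1) c (th - PI / 2) (euler_op f) eps y))).
      { apply filter_forall; intros ab x _.
        unfold minus, plus, opp, scal; simpl; unfold mult; simpl; ring. }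
      apply (is_RInt_gen_minus (V := R_NormedModule)); [apply (is_RInt_gen_minus (V := R_NormedModule))|].
      * apply (is_RInt_gen_primitive _ (osc_integrand b c (th - PI / 2) f eps)); try apply _.
        -- intros x Hx.
           apply (continuous_plus (V := R_NormedModule)); [apply (continuous_plus (V := R_NormedModule))|].
           ++ now apply continuous_pos_osc.
           ++ apply continuous_pos_mult; [intros z _; apply continuous_const | now apply continuous_pos_osc | exact Hx].
           ++ apply continuous_pos_mult; [intros z _; apply continuous_const | apply continuous_pos_osc, half_schwartz_euler_op, Hf | exact Hx].
        -- intros x Hx; now apply is_derive_osc.
        -- unfold at_point; lra.
        -- apply p_infty_pos.
        -- now apply filterlim_at_point.
        -- apply osc_integrand_limit_infty; try assumption; lra.
      * apply (is_RInt_gen_scal (V := R_NormedModule)); now apply H1.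
      * apply (is_RInt_gen_scal (V := R_NormedModule)); now apply H2.
    + replace ((- cos (1 + (th - PI / 2)) - (b - 1) * L) * f 0)
        with (- cos (1 + (th - PI / 2)) * f 0 + (- (b - 1) * (L * f 0) + - c * (L * euler_op f 0)))
        by (unfold euler_op; ring).
      apply filterlim_ext with (fun eps => - cos (1 + (th - PI / 2)) * f eps + (- (b - 1) * I1 eps + - c * I2 eps)).
      { intros eps; unfold osc_integrand; rewrite !Rpower_1_l, !Rmult_1_r; ring. }
      apply filterlim_Rplus; [apply _| |].
      { apply filterlim_mult_const with (f 0); [apply _| |reflexivity].
        exact (filterlim_comp _ _ _ (fun x => x) _ _ _ _ filterlim_at_right_locally (half_schwartz_continuous f 0 Hf)). }
      apply filterlim_Rplus; [apply _| |].
      * apply filterlim_mult_const with (L * f 0); [apply _|exact H1'|reflexivity].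
      * apply filterlim_mult_const with (L * euler_op f 0); [apply _|exact H2'|reflexivity].
Qed.

(** [L] is quantified before [c] and [f]. This order is what allows it to be computed from one
    convenient pair. *)
Lemma osc_limit (C0 a th : R) (HC0 : 0 < C0) (Ha : 0 < a) :
  exists L : R, forall c f, 0 < c <= C0 -> half_schwartz f ->
  exists I : R -> R,
    (forall eps, 0 < eps ->
       is_RInt_gen (osc_integrand a c th f eps) (at_right 0) (Rbar_locally p_infty) (I eps)) /\
    filterlim I (at_right 0) (locally (L * f 0)).
Proof.
  destruct (INR_unbounded (a + C0)) as [n Hn].
  destruct (osc_tail C0 HC0 n a th Hn) as [L1 HL1].
  destruct (is_RInt_gen_power_0 (fun y => cos (y + th) * Rpower y (a - 1)) 1 a) as [L0 [HL0 _]].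
  - lra.
  - apply continuous_pos_mult; [|apply continuous_pos_Rpower].
    intros x _; apply (ex_derive_continuous (K := R_AbsRing) (V := R_NormedModule)).
    auto_derive; exact I.
  - intros y Hy; rewrite Rabs_mult, (Rabs_right (Rpower y (a - 1))) by (apply Rle_ge, Rlt_le, Rpower_pos).
    apply Rmult_le_compat_r; [apply Rlt_le, Rpower_pos | apply Rabs_cos_le].
  - exists (L0 + L1); intros c f Hc Hf.
    destruct (HL1 c f Hc Hf) as [I1 [H1 H1']].
    destruct (osc_dominated (at_right 0) (at_point 1) _ _ a c th f L0) as [I0 [H0 H0']]; try assumption.
    { intros r h M -> Hh HM; apply is_RInt_gen_power_0; try assumption; lra. }
    exists (fun eps => I0 eps + I1 eps); split.
    + intros eps He; apply (is_RInt_gen_Chasles (V := R_NormedModule) _ 1); auto.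
    + rewrite Rmult_plus_distr_r.
      exact (filterlim_Rplus _ _ _ _ _ _ H0' H1').
Qed.

(** * Euler's Gamma integral *)

(** The maximum of t^s e^{-t} is s^s e^{-s}, at t = s; the factor e^{-s} < 1 is dropped. The proof
    is ln v <= v - 1 at v = t/s. *)
Lemma Rpower_mult_exp_le (s t : R) : 0 < s -> 0 < t -> Rpower t s * exp (- t) <= Rpower s s.
Proof.
  intros Hs Ht; unfold Rpower; rewrite <- exp_plus.
  apply Rnot_lt_le; intros H; apply exp_lt_inv in H.
  assert (H1 : ln (t / s) <= t / s - 1).
  { generalize (exp_ineq1_le (ln (t / s))); rewrite exp_ln by now apply Rdiv_lt_0_compat. lra. }
  rewrite ln_div in H1 by assumption.
  apply Rmult_le_compat_l with (r := s) in H1; [|lra].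
  replace (s * (t / s - 1)) with (t - s) in H1 by (field; lra); lra.
Qed.

Lemma is_derive_n_exp_opp (n : nat) (x : R) :
  is_derive_n (fun t => exp (- t)) n x ((-1) ^ n * exp (- x)).
Proof.
  revert x; induction n as [|n IH]; intros x.
  - simpl; ring.
  - apply is_derive_ext with (fun t => (-1) ^ n * exp (- t)).
    + intros t; symmetry; apply is_derive_n_unique, IH.
    + auto_derive; [exact I|simpl; ring].
Qed.

Lemma half_schwartz_exp_opp : half_schwartz (fun t => exp (- t)).
Proof.
  split.
  - intros n x; destruct n as [|n]; [exact I|].
    eexists; apply (is_derive_n_exp_opp (S n)).
  (* The summand 1 serves m = 0, where the bound by s^s with s > 0 does not apply. *)
  - intros m n; exists (1 + Rpower (INR m) (INR m)); intros x Hx.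
    rewrite (is_derive_n_unique _ _ _ _ (is_derive_n_exp_opp n x)).
    rewrite !Rabs_mult, pow_1_abs, Rmult_1_l, (Rabs_right (exp _)), (Rabs_right (x ^ m)).
    2: apply Rle_ge, pow_le; lra.
    2: apply Rle_ge, Rlt_le, exp_pos.
    generalize (Rpower_pos (INR m) (INR m)); intros Hp.
    destruct m as [|m].
    + simpl pow; rewrite Rmult_1_l.
      assert (exp (- x) < exp 0) by (apply exp_increasing; lra); rewrite exp_0 in H; lra.
    + rewrite <- Rpower_pow by exact Hx.
      generalize (Rpower_mult_exp_le (INR (S m)) x); intros H.
      specialize (H (lt_0_INR (S m) (PeanoNat.Nat.lt_0_succ m)) Hx); lra.
Qed.

Lemma continuous_pos_Gamma_integrand (x : R) :
  continuous_pos (fun t => exp (- t) * Rpower t (x - 1)).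
Proof.
  apply continuous_pos_mult; [|apply continuous_pos_Rpower].
  intros z _; apply (ex_derive_continuous (K := R_AbsRing) (V := R_NormedModule)).
  auto_derive; exact I.
Qed.

Lemma Gamma_integrand_pos (x t : R) : 0 < exp (- t) * Rpower t (x - 1).
Proof. apply Rmult_lt_0_compat; [apply exp_pos | apply Rpower_pos]. Qed.

Lemma is_RInt_gen_Gamma (x : R) : 0 < x ->
  is_RInt_gen (fun t => exp (- t) * Rpower t (x - 1)) (at_right 0) (Rbar_locally p_infty) (Gamma x).
Proof.
  intros Hx; apply (RInt_gen_correct (V := R_CompleteNormedModule)).
  destruct (is_RInt_gen_power_0 (fun t => exp (- t) * Rpower t (x - 1)) 1 x) as [l0 [H0 _]].
  - exact Hx.
  - apply continuous_pos_Gamma_integrand.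
  - intros y Hy; rewrite Rabs_right by (apply Rle_ge, Rlt_le, Gamma_integrand_pos).
    apply Rmult_le_compat_r; [apply Rlt_le, Rpower_pos|].
    rewrite <- exp_0; apply Rlt_le, exp_increasing; lra.
  (* At infinity the integrand is t^(x+1) e^{-t} times t^{-2}, and t^(x+1) e^{-t} is at most
     (x+1)^(x+1). *)
  - destruct (is_RInt_gen_power_infty (fun t => exp (- t) * Rpower t (x - 1))
       (Rpower (x + 1) (x + 1)) (-1)) as [l1 [H1 _]].
    + lra.
    + apply continuous_pos_Gamma_integrand.
    + intros y Hy; rewrite Rabs_right by (apply Rle_ge, Rlt_le, Gamma_integrand_pos).
      replace (x - 1) with ((x + 1) + (-1 - 1)) by ring; rewrite Rpower_plus, <- Rmult_assoc.
      apply Rmult_le_compat_r; [apply Rlt_le, Rpower_pos|].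
      rewrite Rmult_comm; apply Rpower_mult_exp_le; lra.
    + exists (plus l0 l1); now apply (is_RInt_gen_Chasles (V := R_NormedModule) _ 1).
Qed.

Lemma filterlim_Rpower_mult_exp (x : R) : 0 < x ->
  filterlim (fun t => exp (- t) * Rpower t x) (Rbar_locally p_infty) (locally 0).
Proof.
  intros Hx.
  apply (filterlim_squeeze_0 _ _ _ (fun t => Rpower (x + 1) (x + 1) * Rpower t (-1))).
  - exists 0; intros t Ht.
    rewrite Rabs_right by (apply Rle_ge, Rmult_le_pos; apply Rlt_le; [apply exp_pos | apply Rpower_pos]).
    replace x with ((x + 1) + -1) at 1 by ring; rewrite Rpower_plus, <- Rmult_assoc.
    apply Rmult_le_compat_r; [apply Rlt_le, Rpower_pos|].
    rewrite Rmult_comm; apply Rpower_mult_exp_le; lra.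
  - apply filterlim_mult_const with 0; [apply _| |ring].
    apply filterlim_Rpower_neg_p_infty; lra.
Qed.

(** Integration by parts: Gamma(x+1) - x Gamma(x) is the integral of the derivative of -e^{-t} t^x,
    which tends to 0 at both ends. Uniqueness of the improper integral then gives the equation. *)
Lemma Gamma_succ (x : R) : 0 < x -> Gamma (x + 1) = x * Gamma x.
Proof.
  intros Hx.
  assert (H0 : is_RInt_gen (fun t => minus (exp (- t) * Rpower t (x + 1 - 1))
      (scal x (exp (- t) * Rpower t (x - 1)))) (at_right 0) (Rbar_locally p_infty)
      (minus (Gamma (x + 1)) (scal x (Gamma x)))).
  { apply (is_RInt_gen_minus (V := R_NormedModule)); [apply is_RInt_gen_Gamma; lra|].
    now apply (is_RInt_gen_scal (V := R_NormedModule)), is_RInt_gen_Gamma. }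
  assert (H1 : is_RInt_gen (fun t => minus (exp (- t) * Rpower t (x + 1 - 1))
      (scal x (exp (- t) * Rpower t (x - 1)))) (at_right 0) (Rbar_locally p_infty) (0 - 0)).
  { apply (is_RInt_gen_primitive _ (fun t => - 1 * (exp (- t) * Rpower t x))); try apply _.
    - intros t Ht; apply (continuous_minus (V := R_NormedModule)).
      + now apply continuous_pos_Gamma_integrand.
      + apply (continuous_scal_r (V := R_NormedModule)); now apply continuous_pos_Gamma_integrand.
    - intros t Ht; unfold Rpower; auto_derive; [exact Ht|].
      change (-1 * (- (1) * exp (- t) * exp (x * ln t) + exp (- t) * (x * (1 * / t) * exp (x * ln t))) =
        exp (- t) * exp ((x + 1 - 1) * ln t) - x * (exp (- t) * exp ((x - 1) * ln t))).
      replace ((x + 1 - 1) * ln t) with (x * ln t) by ring.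
      replace ((x - 1) * ln t) with (x * ln t + - ln t) by ring.
      rewrite exp_plus, (exp_Ropp (ln t)), exp_ln by exact Ht; field; lra.
    - apply at_right_pos.
    - apply p_infty_pos.
    - apply filterlim_mult_const with 0; [apply _| |ring].
      apply (filterlim_squeeze_0 _ _ _ (fun t => Rpower t x)); [|now apply filterlim_Rpower_0].
      exists (mkposreal 1 Rlt_0_1); intros t _ Ht.
      rewrite Rabs_right by (apply Rle_ge, Rmult_le_pos; apply Rlt_le; [apply exp_pos | apply Rpower_pos]).
      rewrite <- (Rmult_1_l (Rpower t x)) at 2; apply Rmult_le_compat_r; [apply Rlt_le, Rpower_pos|].
      rewrite <- exp_0; apply Rlt_le, exp_increasing; lra.
    - apply filterlim_mult_const with 0; [apply _| |ring].
      now apply filterlim_Rpower_mult_exp. }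
  assert (E := is_RInt_gen_unique (V := R_CompleteNormedModule) _ _ H0).
  rewrite (is_RInt_gen_unique (V := R_CompleteNormedModule) _ _ H1) in E.
  change (0 - 0 = Gamma (x + 1) - x * Gamma x) in E; lra.
Qed.

Lemma filterlim_exp_opp_0 : filterlim (fun t => exp (- t)) (at_right 0) (locally 1).
Proof.
  assert (C : continuous (fun t => exp (- t)) 0).
  { apply (ex_derive_continuous (K := R_AbsRing) (V := R_NormedModule) (fun t => exp (- t)) 0).
    auto_derive; exact I. }
  unfold continuous in C; rewrite Ropp_0, exp_0 in C.
  exact (filterlim_comp _ _ _ (fun x => x) _ _ _ _ filterlim_at_right_locally C).
Qed.

Lemma Gamma_1 : Gamma 1 = 1.
Proof.
  transitivity (0 - (-1 * 1)); [|ring].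
  unfold Gamma; refine (is_RInt_gen_unique (V := R_CompleteNormedModule) _ _ _).
  apply (is_RInt_gen_primitive _ (fun t => -1 * exp (- t))); try apply _.
  - apply continuous_pos_Gamma_integrand.
  - intros t Ht; auto_derive; [exact I|].
    unfold Rpower; replace ((1 - 1) * ln t) with 0 by ring; rewrite exp_0; ring.
  - apply at_right_pos.
  - apply p_infty_pos.
  - apply filterlim_mult_const with 1; [apply _ | apply filterlim_exp_opp_0 | reflexivity].
  - apply filterlim_mult_const with 0; [apply _ | | ring].
    apply (filterlim_comp _ _ _ Ropp exp _ (Rbar_locally m_infty)).
    + apply (filterlim_Rbar_opp p_infty).
    + apply is_lim_exp_m.
Qed.

(* Convexity of the exponential, the source of the log-convexity of Gamma. *)
Lemma exp_mult_le (x u : R) : 0 <= x <= 1 -> exp (x * u) <= 1 - x + x * exp u.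
Proof.
  intros Hx.
  (* The tangent line of exp at x u lies below its graph at u and at 0; these two inequalities are
     added with weights x and 1 - x. *)
  assert (H1 := exp_ineq1_le (u - x * u)); assert (H2 := exp_ineq1_le (- (x * u))).
  assert (P := exp_pos (x * u)).
  apply Rmult_le_compat_l with (r := x * exp (x * u)) in H1; [|apply Rmult_le_pos; lra].
  apply Rmult_le_compat_l with (r := (1 - x) * exp (x * u)) in H2; [|apply Rmult_le_pos; lra].
  assert (E1 : exp (x * u) * exp (u - x * u) = exp u) by (rewrite <- exp_plus; f_equal; ring).
  assert (E2 : exp (x * u) * exp (- (x * u)) = 1) by (rewrite <- exp_plus, <- exp_0; f_equal; ring).
  rewrite (Rmult_assoc x _ (exp (u - x * u))), E1 in H1.
  rewrite (Rmult_assoc (1 - x) _ (exp (- (x * u)))), E2 in H2.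
  nra.
Qed.

(** For the weight e^{-t} t^(s-1) / Gamma(s) the mean of t is s, by Gamma(s+1) = s Gamma(s). The
    concave function t^x lies below its tangent at t = s, that is t^x <= s^x (1 - x + x t/s), and
    integration gives the claim without Hoelder's inequality. *)
Lemma Gamma_add_le (s x : R) : 0 < s -> 0 <= x <= 1 -> Gamma (s + x) <= Rpower s x * Gamma s.
Proof.
  intros Hs Hx.
  assert (H1 : is_RInt_gen (fun t => exp (- t) * Rpower t (s + x - 1)) (at_right 0) (Rbar_locally p_infty) (Gamma (s + x)))
    by (apply is_RInt_gen_Gamma; lra).
  assert (H2 : is_RInt_gen (fun t => plus
     (scal (Rpower s x * (1 - x)) (exp (- t) * Rpower t (s - 1)))
     (scal (Rpower s x * x / s) (exp (- t) * Rpower t (s + 1 - 1)))) (at_right 0) (Rbar_locally p_infty)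
     (plus (scal (Rpower s x * (1 - x)) (Gamma s)) (scal (Rpower s x * x / s) (Gamma (s + 1))))).
  { apply (is_RInt_gen_plus (V := R_NormedModule)); apply (is_RInt_gen_scal (V := R_NormedModule));
      apply is_RInt_gen_Gamma; lra. }
  replace (Rpower s x * Gamma s) with
    (Rpower s x * (1 - x) * (Gamma s) + (Rpower s x * x / s) * (Gamma (s + 1)))
    by (rewrite Gamma_succ by exact Hs; field; lra).
  apply Rle_trans with (1 := Rle_abs _).
  refine (RInt_gen_norm (V := R_CompleteNormedModule) _ _ _ _ _ _ H1 H2).
  - apply (Filter_prod _ _ _ (fun a => a < 1) (fun b => 1 < b)).
    + exists (mkposreal 1 Rlt_0_1); intros y Hy _.
      change R in y; change (Rabs (y - 0) < 1) in Hy; apply Rabs_lt_between in Hy; lra.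
    + exists 1; auto.
    + intros a b; simpl; lra.
  - apply (Filter_prod _ _ _ (fun a => 0 < a) (fun b => True)).
    + apply at_right_pos.
    + exists 0; auto.
    + intros a b Ha _ t [Ht _]; simpl in Ht.
      change (Rabs (exp (- t) * Rpower t (s + x - 1)) <=
        Rpower s x * (1 - x) * (exp (- t) * Rpower t (s - 1)) +
        Rpower s x * x / s * (exp (- t) * Rpower t (s + 1 - 1))).
      rewrite Rabs_right by (apply Rle_ge, Rlt_le, Gamma_integrand_pos).
      replace (s + x - 1) with ((s - 1) + x) by ring.
      replace (s + 1 - 1) with ((s - 1) + 1) by ring.
      rewrite !Rpower_plus, Rpower_1 by lra.
      assert (B := exp_mult_le x (ln (t / s)) Hx).
      rewrite exp_ln, ln_div in B by (try apply Rdiv_lt_0_compat; lra).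
      assert (E : Rpower t x = Rpower s x * exp (x * (ln t - ln s))).
      { unfold Rpower; rewrite <- exp_plus; f_equal; ring. }
      rewrite E.
      replace (Rpower s x * (1 - x) * (exp (- t) * Rpower t (s - 1)) +
         Rpower s x * x / s * (exp (- t) * (Rpower t (s - 1) * t)))
        with (exp (- t) * (Rpower t (s - 1) * (Rpower s x * (1 - x + x * (t / s))))) by (field; lra).
      apply Rmult_le_compat_l; [apply Rlt_le, exp_pos|].
      apply Rmult_le_compat_l; [apply Rlt_le, Rpower_pos|].
      apply Rmult_le_compat_l; [apply Rlt_le, Rpower_pos|]. exact B.
Qed.

(** * Rotation of the ray of integration *)

(** The real part of e^{i th} e^{-z} z^(a-1) dz/du along the ray z = u e^{-i phi}. *)
Definition rot_integrand (a th phi u : R) : R :=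
  exp (- (u * cos phi)) * cos (u * sin phi + th - a * phi) * Rpower u (a - 1).

(** The real part of e^{i th} e^{-z} z^(a-1) dz/dphi, where dz/dphi = -i z. Since the form e^{-z}
    z^(a-1) dz is closed, its u-derivative is the phi-derivative of [rot_integrand]; [rot_dphi] is
    their common value. *)
Definition rot_primitive (a th phi u : R) : R :=
  exp (- (u * cos phi)) * sin (u * sin phi + th - a * phi) * Rpower u a.

Definition rot_dphi (a th phi u : R) : R :=
  (u * sin phi * cos (u * sin phi + th - a * phi)
   - (u * cos phi - a) * sin (u * sin phi + th - a * phi))
  * exp (- (u * cos phi)) * Rpower u (a - 1).

Lemma is_derive_rot_integrand (a th phi u : R) :
  is_derive (fun z => rot_integrand a th z u) phi (rot_dphi a th phi u).
Proof.
  unfold rot_integrand, rot_dphi; auto_derive; [exact I|].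
  unfold Rminus; ring.
Qed.

Lemma is_derive_rot_primitive (a th phi u : R) : 0 < u ->
  is_derive (fun z => rot_primitive a th phi z) u (rot_dphi a th phi u).
Proof.
  intros Hu; unfold rot_primitive, rot_dphi, Rpower; auto_derive; [exact Hu|].
  assert (E : exp ((a - 1) * ln u) = exp (a * ln u) / u).
  { replace ((a - 1) * ln u) with (a * ln u + - ln u) by ring.
    rewrite exp_plus, exp_Ropp, exp_ln by exact Hu; reflexivity. }
  rewrite E; unfold Rminus; field; lra.
Qed.

Lemma continuous_pos_rot_integrand (a th phi : R) : continuous_pos (rot_integrand a th phi).
Proof.
  intros u Hu; apply (ex_derive_continuous (K := R_AbsRing) (V := R_NormedModule)).
  unfold rot_integrand, Rpower; auto_derive; exact Hu.
Qed.

Lemma continuous_pos_rot_dphi (a th phi : R) : continuous_pos (rot_dphi a th phi).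
Proof.
  intros u Hu; apply (ex_derive_continuous (K := R_AbsRing) (V := R_NormedModule)).
  unfold rot_dphi, Rpower; auto_derive; exact Hu.
Qed.

Lemma continuity_2d_rot_dphi (a th phi u : R) : 0 < u -> continuity_2d_pt (rot_dphi a th) phi u.
Proof.
  intros Hu; unfold rot_dphi.
  assert (Cs : continuity_2d_pt (fun x y => sin x) phi u).
  { apply (continuity_1d_2d_pt_comp sin (fun x _ => x)); [apply continuity_sin | apply continuity_2d_pt_id1]. }
  assert (Cc : continuity_2d_pt (fun x y => cos x) phi u).
  { apply (continuity_1d_2d_pt_comp cos (fun x _ => x)); [apply continuity_cos | apply continuity_2d_pt_id1]. }
  assert (Cu : continuity_2d_pt (fun x y => y) phi u) by apply continuity_2d_pt_id2.
  assert (Cus := continuity_2d_pt_mult _ _ _ _ Cu Cs).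
  assert (Cuc := continuity_2d_pt_mult _ _ _ _ Cu Cc).
  assert (Cpsi : continuity_2d_pt (fun x y => y * sin x + th - a * x) phi u).
  { apply continuity_2d_pt_minus; [apply continuity_2d_pt_plus; [exact Cus|apply continuity_2d_pt_const]|].
    apply (continuity_2d_pt_mult (fun _ _ => a)); [apply continuity_2d_pt_const | apply continuity_2d_pt_id1]. }
  repeat apply continuity_2d_pt_mult.
  - apply continuity_2d_pt_minus; repeat apply continuity_2d_pt_mult; try assumption.
    + apply (continuity_1d_2d_pt_comp cos); [apply continuity_cos | exact Cpsi].
    + apply continuity_2d_pt_minus; [exact Cuc | apply continuity_2d_pt_const].
    + apply (continuity_1d_2d_pt_comp sin); [apply continuity_sin | exact Cpsi].
  - apply (continuity_1d_2d_pt_comp exp); [apply derivable_continuous_pt, derivable_exp |].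
    now apply continuity_2d_pt_opp.
  - apply (continuity_1d_2d_pt_comp (fun y => Rpower y (a - 1)) (fun _ y => y)); [|exact Cu].
    apply continuity_pt_filterlim; now apply continuous_pos_Rpower.
Qed.

(** This takes the place of Cauchy's theorem on the sector between the radii [al] and [be]:
    differentiation under the integral followed by the fundamental theorem leaves only the
    contributions of the two arcs. *)
Lemma is_derive_RInt_rot (a th al be phi : R) : 0 < al -> 0 < be ->
  is_derive (fun z => RInt (rot_integrand a th z) al be) phi
    (rot_primitive a th phi be - rot_primitive a th phi al).
Proof.
  intros Hal Hbe.
  assert (Hmin : 0 < Rmin al be) by now apply Rmin_glb_lt.
  replace (rot_primitive a th phi be - rot_primitive a th phi al)
    with (RInt (fun t => Derive (fun z => rot_integrand a th z t) phi) al be).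
  - apply is_derive_RInt_param.
    + apply filter_forall; intros x t _; eexists; apply is_derive_rot_integrand.
    + intros t [Ht _]; apply continuity_2d_pt_ext with (rot_dphi a th).
      * intros x y; symmetry; apply is_derive_unique, is_derive_rot_integrand.
      * apply continuity_2d_rot_dphi; lra.
    + apply filter_forall; intros x.
      apply ex_RInt_continuous_pos; [apply continuous_pos_rot_integrand | exact Hal | exact Hbe].
  - rewrite (RInt_ext _ (rot_dphi a th phi)).
    2: intros x _; apply is_derive_unique, is_derive_rot_integrand.
    apply (is_RInt_unique (V := R_CompleteNormedModule)).
    apply (is_RInt_derive (V := R_CompleteNormedModule) (rot_primitive a th phi)).
    + intros x [Hx _]; apply is_derive_rot_primitive; lra.
    + intros x [Hx _]; apply continuous_pos_rot_dphi; lra.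
Qed.

(** Exponential decay is uniform for angles up to [phi1], because cos is decreasing and cos phi1 >
    0; at the right angle it would be lost. *)
Lemma Rabs_rot_primitive_le (a th phi phi1 u : R) :
  0 < u -> 0 <= phi <= phi1 -> phi1 < PI / 2 ->
  Rabs (rot_primitive a th phi u) <= exp (- (u * cos phi1)) * Rpower u a.
Proof.
  intros Hu Hp Hp1; unfold rot_primitive; rewrite !Rabs_mult.
  rewrite (Rabs_right (exp _)) by (apply Rle_ge, Rlt_le, exp_pos).
  rewrite (Rabs_right (Rpower _ _)) by (apply Rle_ge, Rlt_le, Rpower_pos).
  apply Rmult_le_compat_r; [apply Rlt_le, Rpower_pos|].
  rewrite <- (Rmult_1_r (exp (- (u * cos phi1)))).
  apply Rmult_le_compat; [apply Rlt_le, exp_pos | apply Rabs_pos | | apply Rabs_le, SIN_bound].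
  apply exp_le_compat, Ropp_le_contravar, Rmult_le_compat_l; [lra|].
  generalize PI_RGT_0; intros Hpi; apply cos_decr_1; lra.
Qed.

(* The rays arg z = 0 and arg z = phi give the same integral of
   [exp (- z) * z^(a-1)]: the phi-derivative of the integrand along the rotated
   ray is the u-derivative of [rot_primitive], which vanishes at both ends. *)
Lemma is_RInt_gen_rot (a th phi : R) : 0 < a -> 0 <= phi < PI / 2 ->
  is_RInt_gen (rot_integrand a th phi) (at_right 0) (Rbar_locally p_infty) (cos th * Gamma a).
Proof.
  intros Ha Hphi.
  assert (Hc : 0 < cos phi) by (apply cos_gt_0; lra).
  apply is_RInt_gen_of_filterlim; try apply _.
  { apply continuous_pos_rot_integrand. }
  { apply at_right_pos. }
  { apply p_infty_pos. }
  assert (H0 : is_RInt_gen (rot_integrand a th 0) (at_right 0) (Rbar_locally p_infty) (cos th * Gamma a)).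
  { apply is_RInt_gen_ext with (fun t => scal (cos th) (exp (- t) * Rpower t (a - 1))).
    - apply filter_forall; intros ab x _; unfold rot_integrand.
      rewrite cos_0, sin_0.
      replace (x * 0 + th - a * 0) with th by ring; rewrite Rmult_1_r.
      change (cos th * (exp (- x) * Rpower x (a - 1)) = exp (- x) * cos th * Rpower x (a - 1)); ring.
    - apply (is_RInt_gen_scal (V := R_NormedModule)); now apply is_RInt_gen_Gamma. }
  apply filterlim_of_is_RInt_gen in H0; try apply _.
  apply filterlim_ext with (fun ab : R * R => RInt (rot_integrand a th 0) (fst ab) (snd ab) +
    (RInt (rot_integrand a th phi) (fst ab) (snd ab) - RInt (rot_integrand a th 0) (fst ab) (snd ab))).
  { intros ab; simpl; unfold Rminus; ring. }
  rewrite <- (Rplus_0_r (cos th * Gamma a)).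
  apply filterlim_Rplus; [apply _ | exact H0 |].
  pose (B := fun u => exp (- (u * cos phi)) * Rpower u a).
  assert (B0 : filterlim B (at_right 0) (locally 0)).
  { apply (filterlim_squeeze_0 _ _ _ (fun t => Rpower t a)); [|now apply filterlim_Rpower_0].
    exists (mkposreal 1 Rlt_0_1); intros t _ Ht; unfold B.
    rewrite Rabs_right by (apply Rle_ge, Rmult_le_pos; apply Rlt_le; [apply exp_pos | apply Rpower_pos]).
    rewrite <- (Rmult_1_l (Rpower t a)) at 2; apply Rmult_le_compat_r; [apply Rlt_le, Rpower_pos|].
    rewrite <- exp_0; apply exp_le_compat; generalize (Rmult_lt_0_compat _ _ Ht Hc); lra. }
  assert (B1 : filterlim B (Rbar_locally p_infty) (locally 0)).
  { apply filterlim_ext_loc with (fun t => / Rpower (cos phi) a * (exp (- (cos phi * t)) * Rpower (cos phi * t) a)).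
    - exists 0; intros t Ht; unfold B.
      rewrite <- Rpower_mult_distr by assumption.
      rewrite (Rmult_comm t); field; apply Rgt_not_eq, Rpower_pos.
    - apply filterlim_mult_const with 0; [apply _ | | ring].
      refine (filterlim_comp _ _ _ (fun t => cos phi * t) (fun t => exp (- t) * Rpower t a) _ _ _ _ (filterlim_Rpower_mult_exp a Ha)).
      intros P [M HM]; exists (M / cos phi); intros x Hx; apply HM.
      apply Rmult_lt_reg_r with (/ cos phi); [now apply Rinv_0_lt_compat|].
      replace (cos phi * x * / cos phi) with x by (field; lra); exact Hx. }
  apply (filterlim_squeeze_0 _ _ _ (fun ab : R * R => phi * (B (snd ab) + B (fst ab)))).
  - apply (Filter_prod _ _ _ (fun x => 0 < x) (fun x => 0 < x)); [apply at_right_pos | apply p_infty_pos |].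
    intros al be Hal Hbe; simpl.
    (* By the mean value theorem in the angle, the integrals over [al, be] on the two rays differ by
       at most phi (B(al) + B(be)), and B tends to 0 at both ends. *)
    destruct (MVT_gen (fun z => RInt (rot_integrand a th z) al be) 0 phi
      (fun z => rot_primitive a th z be - rot_primitive a th z al)) as [c [Hc1 E]].
    + intros x _; exact (is_derive_RInt_rot a th al be x Hal Hbe).
    + intros x _; apply continuity_pt_filterlim.
      apply (ex_derive_continuous (K := R_AbsRing) (V := R_NormedModule) (fun z => RInt (rot_integrand a th z) al be)); eexists; exact (is_derive_RInt_rot a th al be x Hal Hbe).
    + rewrite E, Rmult_comm, Rabs_mult, Rminus_0_r, (Rabs_right phi) by lra.
      rewrite Rmin_left, Rmax_right in Hc1 by lra.
      apply Rmult_le_compat_l; [lra|]; unfold Rminus.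
      apply Rle_trans with (1 := Rabs_triang _ _); rewrite Rabs_Ropp.
      apply Rplus_le_compat; apply Rabs_rot_primitive_le; lra.
  - apply filterlim_mult_const with (0 + 0); [apply _ | | ring].
    apply (filterlim_Rplus _ _ (fun ab : R * R => B (snd ab)) (fun ab => B (fst ab))).
    + exact (filterlim_comp _ _ _ _ _ _ _ _ filterlim_snd B1).
    + exact (filterlim_comp _ _ _ _ _ _ _ _ filterlim_fst B0).
Qed.

(** * Change of variables and evaluation of the limiting constant *)

Lemma is_RInt_gen_subst (h g dg : R -> R) (l : R) :
  continuous_pos h -> continuous_pos dg ->
  (forall x, 0 < x -> 0 < g x) ->
  (forall x, 0 < x -> is_derive g x (dg x)) ->
  filterlim g (at_right 0) (at_right 0) -> filterlim g (Rbar_locally p_infty) (Rbar_locally p_infty) ->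
  is_RInt_gen h (at_right 0) (Rbar_locally p_infty) l ->
  is_RInt_gen (fun x => dg x * h (g x)) (at_right 0) (Rbar_locally p_infty) l.
Proof.
  intros Hh Hdg Hg0 Hg G0 G1 Hl.
  assert (Hcont : forall x, 0 < x -> continuous g x).
  { intros x Hx; apply (ex_derive_continuous (K := R_AbsRing) (V := R_NormedModule)).
    eexists; now apply Hg. }
  apply is_RInt_gen_of_filterlim; try apply _.
  - intros x Hx; apply (continuous_mult (K := R_AbsRing)); [now apply Hdg|].
    apply (continuous_comp g h); [now apply Hcont | apply Hh; now apply Hg0].
  - apply at_right_pos.
  - apply p_infty_pos.
  - apply filterlim_of_is_RInt_gen in Hl; try apply _.
    apply filterlim_ext_loc with (fun ab : R * R => RInt h (g (fst ab)) (g (snd ab))).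
    + apply (Filter_prod _ _ _ (fun x => 0 < x) (fun x => 0 < x)); [apply at_right_pos | apply p_infty_pos |].
      intros a b Ha Hb; simpl; symmetry.
      assert (Hmin : 0 < Rmin a b) by now apply Rmin_glb_lt.
      apply (RInt_comp (V := R_CompleteNormedModule) h g dg).
      * intros x [Hx _]; apply Hh, Hg0; lra.
      * intros x [Hx _]; split; [apply Hg | apply Hdg]; lra.
    + intros P HP; destruct (Hl P HP) as [Q1 Q2 HQ1 HQ2 HQ].
      apply (Filter_prod _ _ _ (fun x => Q1 (g x)) (fun x => Q2 (g x))).
      * exact (G0 Q1 HQ1).
      * exact (G1 Q2 HQ2).
      * intros x y Hx Hy; exact (HQ _ _ Hx Hy).
Qed.

Lemma filterlim_scal_at_right (k : R) : 0 < k -> filterlim (fun x => k * x) (at_right 0) (at_right 0).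
Proof.
  intros Hk P [e He].
  assert (Hd : 0 < e / k) by (apply Rdiv_lt_0_compat; [apply cond_pos | exact Hk]).
  exists (mkposreal _ Hd); intros x Hx Hx0; change R in x.
  change (Rabs (x - 0) < e / k) in Hx; rewrite Rminus_0_r, Rabs_right in Hx by lra.
  apply He; [|now apply Rmult_lt_0_compat].
  change (Rabs (k * x - 0) < e).
  rewrite Rminus_0_r, Rabs_right by (apply Rle_ge, Rmult_le_pos; lra).
  apply Rmult_lt_reg_r with (/ k); [now apply Rinv_0_lt_compat|].
  replace (k * x * / k) with x by (field; lra); exact Hx.
Qed.

Lemma filterlim_scal_p_infty (k : R) :
  0 < k -> filterlim (fun x => k * x) (Rbar_locally p_infty) (Rbar_locally p_infty).
Proof.
  intros Hk P [M HM]; exists (M / k); intros x Hx; apply HM.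
  apply Rmult_lt_reg_r with (/ k); [now apply Rinv_0_lt_compat|].
  replace (k * x * / k) with x by (field; lra); exact Hx.
Qed.

(** Here e^{iy} e^{-eps y} = e^{-(eps - i) y} and eps - i = k e^{-i phi}, with k = 1/cos(atan eps)
    and phi = pi/2 - atan eps < pi/2. Substituting u = k y gives the Gamma integral along a rotated
    ray; the power of the cosine in the value is k^{-a}. *)
Lemma is_RInt_gen_osc_exp (a th eps : R) : 0 < a -> 0 < eps ->
  is_RInt_gen (osc_integrand a 1 th (fun t => exp (- t)) eps) (at_right 0) (Rbar_locally p_infty)
    (Rpower (cos (atan eps)) a * (cos (th + a * (PI / 2 - atan eps)) * Gamma a)).
Proof.
  intros Ha He.
  destruct (atan_bound eps) as [_ Hb].
  assert (Hat : 0 < atan eps) by (rewrite <- atan_0; now apply atan_increasing).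
  pose (phi := PI / 2 - atan eps).
  assert (Es : sin phi = cos (atan eps)) by (unfold phi; rewrite sin_shift; reflexivity).
  assert (Ec : cos phi = sin (atan eps)) by (unfold phi; rewrite cos_shift; reflexivity).
  assert (Hs : 0 < cos (atan eps)) by (apply cos_gt_0; lra).
  assert (Hphi : 0 <= phi < PI / 2) by (unfold phi; lra).
  (* The phase is raised by [a * phi] to undo the term [- a * phi] built into [rot_integrand]. *)
  assert (H := is_RInt_gen_rot a (th + a * phi) phi Ha Hphi).
  pose (k := / cos (atan eps)).
  assert (Hk : 0 < k) by now apply Rinv_0_lt_compat.
  apply (is_RInt_gen_subst _ (fun y => k * y) (fun _ => k)) in H.
  - apply (is_RInt_gen_scal (V := R_NormedModule) _ (Rpower (cos (atan eps)) a)) in H.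
    refine (is_RInt_gen_ext _ _ _ _ H).
    apply (Filter_prod _ _ _ (fun x => 0 < x) (fun x => 0 < x)); [apply at_right_pos | apply p_infty_pos |].
    intros al be Hal Hbe y [Hy _]; simpl in Hy.
    assert (Hy0 : 0 < y) by (apply Rlt_trans with (2 := Hy); now apply Rmin_glb_lt).
    change (Rpower (cos (atan eps)) a * (k * rot_integrand a (th + a * phi) phi (k * y)) =
      osc_integrand a 1 th (fun t => exp (- t)) eps y).
    unfold rot_integrand, osc_integrand.
    rewrite Rpower_1, Es, Ec by exact Hy0.
    assert (E1 : k * y * sin (atan eps) = eps * y).
    { rewrite <- (tan_atan eps) at 2; unfold tan, k; field; lra. }
    assert (E2 : k * y * cos (atan eps) + (th + a * phi) - a * phi = y + th) by (unfold k; field; lra).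
    rewrite E1, E2.
    rewrite <- Rpower_mult_distr by assumption.
    assert (E3 : Rpower (cos (atan eps)) a * (k * Rpower k (a - 1)) = 1).
    { unfold k; rewrite <- (Rpower_1 (/ cos (atan eps))) at 1 by (now apply Rinv_0_lt_compat).
      rewrite <- Rpower_plus, Rpower_Rinv_base by exact Hs.
      rewrite <- Rpower_plus; replace (a + - (1 + (a - 1))) with 0 by ring; now apply Rpower_O. }
    replace (Rpower (cos (atan eps)) a * (k * (exp (- (eps * y)) * cos (y + th) * (Rpower k (a - 1) * Rpower y (a - 1)))))
      with ((Rpower (cos (atan eps)) a * (k * Rpower k (a - 1))) * (cos (y + th) * Rpower y (a - 1) * exp (- (eps * y)))) by ring.
    rewrite E3; ring.
  - apply continuous_pos_rot_integrand.
  - intros x _; apply continuous_const.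
  - intros x Hx; now apply Rmult_lt_0_compat.
  - intros x Hx; auto_derive; [exact I | ring].
  - now apply filterlim_scal_at_right.
  - now apply filterlim_scal_p_infty.
Qed.

Lemma osc_limit_Gamma (a c th : R) (f : R -> R) : 0 < a -> 0 < c -> half_schwartz f ->
  exists I : R -> R,
    (forall eps, 0 < eps ->
       is_RInt_gen (osc_integrand a c th f eps) (at_right 0) (Rbar_locally p_infty) (I eps)) /\
    filterlim I (at_right 0) (locally (cos (th + a * (PI / 2)) * Gamma a * f 0)).
Proof.
  intros Ha Hc Hf.
  (* The bound [c + 1] covers both the given c and the value 1 used with e^{-t}, so the two share
     the same [L]. *)
  assert (HC0 : 0 < c + 1) by lra.
  destruct (osc_limit (c + 1) a th HC0 Ha) as [L HL].
  replace (cos (th + a * (PI / 2)) * Gamma a) with L; [apply HL; [lra | exact Hf]|].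
  destruct (HL 1 (fun t => exp (- t))) as [J [HJ HJ']]; [lra | apply half_schwartz_exp_opp|].
  rewrite Ropp_0, exp_0, Rmult_1_r in HJ'.
  pose (V := fun eps => Rpower (cos (atan eps)) a * (cos (th + a * (PI / 2 - atan eps)) * Gamma a)).
  assert (HV : filterlim V (at_right 0) (locally (cos (th + a * (PI / 2)) * Gamma a))).
  { replace (cos (th + a * (PI / 2)) * Gamma a) with (V 0).
    - refine (filterlim_comp _ _ _ (fun x => x) V _ _ _ filterlim_at_right_locally _).
      apply (ex_derive_continuous (K := R_AbsRing) (V := R_NormedModule)).
      unfold V, Rpower; auto_derive.
      rewrite atan_0, cos_0; lra.
    - unfold V; rewrite atan_0, cos_0, Rpower_1_l, Rminus_0_r; ring. }
  apply (filterlim_locally_unique (F := at_right 0) J); [exact HJ'|].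
  apply filterlim_ext_loc with (2 := HV).
  exists (mkposreal 1 Rlt_0_1); intros eps _ He.
  rewrite <- (is_RInt_gen_unique (V := R_CompleteNormedModule) _ _ (HJ eps He)).
  symmetry; refine (is_RInt_gen_unique (V := R_CompleteNormedModule) _ _ _).
  now apply is_RInt_gen_osc_exp.
Qed.

(** With y = x^p, x^(q-1) dx becomes p^{-1} y^(q/p-1) dy and eps x becomes eps y^(1/p). *)
Lemma osc_power_limit (p q th : R) (f : R -> R) : 0 < p -> 0 < q -> half_schwartz f ->
  exists I : R -> R,
    (forall eps, 0 < eps ->
       is_RInt_gen (fun x => cos (Rpower x p + th) * Rpower x (q - 1) * f (eps * x))
         (at_right 0) (Rbar_locally p_infty) (I eps)) /\
    filterlim I (at_right 0) (locally (/ p * cos (th + q / p * (PI / 2)) * Gamma (q / p) * f 0)).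
Proof.
  intros Hp Hq Hf.
  assert (Ha : 0 < q / p) by now apply Rdiv_lt_0_compat.
  assert (Hc : 0 < / p) by now apply Rinv_0_lt_compat.
  destruct (osc_limit_Gamma (q / p) (/ p) th f Ha Hc Hf) as [J [HJ HJ']].
  exists (fun eps => / p * J eps); split.
  - intros eps He; assert (H := HJ eps He).
    apply (is_RInt_gen_subst _ (fun x => Rpower x p) (fun x => p * Rpower x (p - 1))) in H.
    + apply (is_RInt_gen_scal (V := R_NormedModule) _ (/ p)) in H.
      refine (is_RInt_gen_ext _ _ _ _ H).
      apply (Filter_prod _ _ _ (fun x => 0 < x) (fun x => 0 < x)); [apply at_right_pos | apply p_infty_pos |].
      intros al be Hal Hbe x [Hx _]; simpl in Hx.
      assert (Hx0 : 0 < x) by (apply Rlt_trans with (2 := Hx); now apply Rmin_glb_lt).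
      change (/ p * (p * Rpower x (p - 1) * osc_integrand (q / p) (/ p) th f eps (Rpower x p)) =
        cos (Rpower x p + th) * Rpower x (q - 1) * f (eps * x)).
      unfold osc_integrand; rewrite !Rpower_mult.
      rewrite Rinv_r, Rpower_1 by lra.
      replace (q - 1) with ((p - 1) + p * (q / p - 1)) by (field; lra).
      rewrite Rpower_plus; field; lra.
    + now apply continuous_pos_osc.
    + apply continuous_pos_mult; [intros x _; apply continuous_const | apply continuous_pos_Rpower].
    + intros x _; apply Rpower_pos.
    + intros x Hx; now apply is_derive_Rpower.
    + now apply filterlim_Rpower_at_right.
    + now apply filterlim_Rpower_p_infty.
  - apply filterlim_mult_const with (1 := _) (2 := HJ'). ring.
Qed.

(** * From real integrals to the complex oscillatory integral *)

Lemma locally_C_rect (l : C) (P : C -> Prop) : locally (T := C_UniformSpace) l P ->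
  exists e : posreal, forall x y : R, Rabs (x - fst l) < e -> Rabs (y - snd l) < e -> P (x, y).
Proof.
  intros [e He]; exists e; intros x y Hx Hy; apply He; split; assumption.
Qed.

Lemma is_RInt_gen_C (f1 f2 : R -> R) (Fa Fb : (R -> Prop) -> Prop) (FFa : Filter Fa) (FFb : Filter Fb) (l1 l2 : R) :
  is_RInt_gen f1 Fa Fb l1 -> is_RInt_gen f2 Fa Fb l2 ->
  is_RInt_gen (V := C_R_NormedModule) (fun x => (f1 x, f2 x)) Fa Fb (l1, l2).
Proof.
  intros H1 H2 P HP; destruct (locally_C_rect (l1, l2) P HP) as [e He].
  unfold is_RInt_gen, filterlimi, filter_le, filtermapi in H1, H2.
  assert (K1 := H1 _ (locally_ball l1 e)); assert (K2 := H2 _ (locally_ball l2 e)).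
  refine (filter_imp (F := filter_prod Fa Fb) _ _ _ (filter_and _ _ K1 K2)).
  intros [a b] [[y1 [A1 B1]] [y2 [A2 B2]]]; exists (y1, y2); split.
  - now apply (is_RInt_fct_extend_pair (U := R_NormedModule) (V := R_NormedModule)).
  - now apply He.
Qed.

Lemma filterlim_C {T : Type} (F : (T -> Prop) -> Prop) (FF : Filter F) (f1 f2 : T -> R) (l1 l2 : R) :
  filterlim f1 F (locally l1) -> filterlim f2 F (locally l2) ->
  filterlim (fun x => (f1 x, f2 x)) F (locally (T := C_UniformSpace) (l1, l2)).
Proof.
  intros H1 H2 P HP; destruct (locally_C_rect (l1, l2) P HP) as [e He].
  assert (K1 : F (fun x => ball l1 e (f1 x))) by exact (H1 _ (locally_ball l1 e)).
  assert (K2 : F (fun x => ball l2 e (f2 x))) by exact (H2 _ (locally_ball l2 e)).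
  change (F (fun x => P (f1 x, f2 x))).
  refine (filter_imp _ _ _ (filter_and _ _ K1 K2)).
  intros x [A B]; now apply He.
Qed.

Lemma cexp_sign_Ci (s X : R) : s = 1 \/ s = -1 ->
  cexp (RtoC s * Ci * RtoC X)%C = (cos X, s * sin X).
Proof.
  intros hs; unfold cexp, Re, Im, RtoC, Ci, Cmult; simpl.
  replace ((s * 0 - 0 * 1) * X - (s * 1 + 0 * 0) * 0) with 0 by ring.
  replace ((s * 0 - 0 * 1) * 0 + (s * 1 + 0 * 0) * X) with (s * X) by ring.
  rewrite exp_0; destruct hs as [->| ->].
  - rewrite !Rmult_1_l; reflexivity.
  - replace (-1 * X) with (- X) by ring; rewrite cos_neg, sin_neg; f_equal; ring.
Qed.

(** The phases 0 and [- (PI / 2)] are paired with the real and imaginary parts of chi, which makes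
    four real integrals. As chi(0) = 1, the two that contain the imaginary part of chi tend to 0. *)
Lemma is_Os_integral_fresnel (s p q : R) : s = 1 \/ s = -1 -> 0 < p -> 0 < q ->
  is_Os_integral s p q
    (RtoC (/ p) * cexp (RtoC s * Ci * RtoC (PI / 2 * (q / p))) * RtoC (Gamma (q / p)))%C.
Proof.
  intros hs Hp Hq chi [Hu Hv] Hchi0.
  set (u := fun x => Re (chi x)) in *; set (v := fun x => Im (chi x)) in *.
  apply schwartz_R_half_schwartz in Hu, Hv.
  assert (u0 : u 0 = 1) by (unfold u; now rewrite Hchi0).
  assert (v0 : v 0 = 0) by (unfold v; now rewrite Hchi0).
  destruct (osc_power_limit p q 0 u Hp Hq Hu) as [Iuc [Huc Luc]].
  destruct (osc_power_limit p q (- (PI / 2)) u Hp Hq Hu) as [Ius [Hus Lus]].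
  destruct (osc_power_limit p q 0 v Hp Hq Hv) as [Ivc [Hvc Lvc]].
  destruct (osc_power_limit p q (- (PI / 2)) v Hp Hq Hv) as [Ivs [Hvs Lvs]].
  rewrite u0 in *; rewrite v0 in *.
  assert (sin_cos : forall y, cos (y + - (PI / 2)) = sin y).
  { intros y; change (y + - (PI / 2)) with (y - PI / 2); rewrite cos_minus, sin_PI2, cos_PI2; ring. }
  exists (fun eps => (Iuc eps + - s * Ivs eps, Ivc eps + s * Ius eps)); split.
  - intros eps He.
    apply is_RInt_gen_ext with (fun x =>
      (plus (cos (Rpower x p + 0) * Rpower x (q - 1) * u (eps * x))
            (scal (- s) (cos (Rpower x p + - (PI / 2)) * Rpower x (q - 1) * v (eps * x))),
       plus (cos (Rpower x p + 0) * Rpower x (q - 1) * v (eps * x))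
            (scal s (cos (Rpower x p + - (PI / 2)) * Rpower x (q - 1) * u (eps * x))))).
    + apply filter_forall; intros ab x _.
      rewrite cexp_sign_Ci, sin_cos, Rplus_0_r by exact hs.
      unfold u, v, plus, scal; simpl; unfold mult; simpl.
      destruct (chi (eps * x)) as [c1 c2]; unfold Cmult, RtoC, Re, Im; simpl; f_equal; ring.
    + apply is_RInt_gen_C; try apply _; apply (is_RInt_gen_plus (V := R_NormedModule)).
      * now apply Huc.
      * apply (is_RInt_gen_scal (V := R_NormedModule)); now apply Hvs.
      * now apply Hvc.
      * apply (is_RInt_gen_scal (V := R_NormedModule)); now apply Hus.
  - rewrite cexp_sign_Ci by exact hs.
    replace (RtoC (/ p) * ((cos (PI / 2 * (q / p)))%R, (s * sin (PI / 2 * (q / p)))%R) * RtoC (Gamma (q / p)))%C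
      with (/ p * cos (0 + q / p * (PI / 2)) * Gamma (q / p) * 1
             + - s * (/ p * cos (- (PI / 2) + q / p * (PI / 2)) * Gamma (q / p) * 0),
            / p * cos (0 + q / p * (PI / 2)) * Gamma (q / p) * 0
             + s * (/ p * cos (- (PI / 2) + q / p * (PI / 2)) * Gamma (q / p) * 1)).
    + apply filterlim_C; [apply _| |]; apply filterlim_Rplus; try apply _; try assumption;
        eapply filterlim_mult_const; try apply _; try eassumption; reflexivity.
    + rewrite (Rplus_comm (- (PI / 2))), sin_cos, Rplus_0_l, (Rmult_comm (PI / 2)).
      unfold Cmult, RtoC; simpl; f_equal; ring.
Qed.

(** * Complex differentiability *)

(** [holomorphic_at] refers to [C_NormedModule], while the product and chain rules are applied over
    [AbsRing_NormedModule C_AbsRing]. This elementary form mediates between the two and suits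
    explicit estimates. *)
Definition is_C_derive (f : C -> C) (z d : C) : Prop :=
  forall e : R, 0 < e -> exists r : R, 0 < r /\ forall w : C, Cmod (w - z) < r ->
    Cmod (f w - f z - (w - z) * d) <= e * Cmod (w - z).

Lemma is_C_derive_is_derive (f : C -> C) (z d : C) :
  is_C_derive f z d -> is_derive (K := C_AbsRing) (V := C_NormedModule) f z d.
Proof.
  intros H; split.
  - apply (is_linear_scal_l (K := C_AbsRing) (V := C_NormedModule)).
  - intros x Hx e.
    rewrite <- (is_filter_lim_locally_unique (K := C_AbsRing) (V := AbsRing_NormedModule C_AbsRing) _ _ Hx).
    destruct (H e (cond_pos e)) as [r [Hr0 Hr]].
    exists (mkposreal r Hr0); intros w Hw; exact (Hr w Hw).
Qed.

Lemma is_C_derive_iff (f : C -> C) (z d : C) :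
  is_C_derive f z d <-> is_derive (K := C_AbsRing) (V := AbsRing_NormedModule C_AbsRing) f z d.
Proof.
  split.
  - intros H; split.
    + apply (is_linear_scal_l (K := C_AbsRing) (V := AbsRing_NormedModule C_AbsRing)).
    + intros x Hx e.
      rewrite <- (is_filter_lim_locally_unique (K := C_AbsRing) (V := AbsRing_NormedModule C_AbsRing) _ _ Hx).
      destruct (H e (cond_pos e)) as [r [Hr0 Hr]].
      exists (mkposreal r Hr0); intros w Hw; exact (Hr w Hw).
  - intros [_ H] e He.
    destruct (H z (fun P HP => HP) (mkposreal e He)) as [r Hr].
    exists r; split; [apply cond_pos|]; intros w Hw; exact (Hr w Hw).
Qed.

Definition ex_C_derive (f : C -> C) (z : C) : Prop := exists d, is_C_derive f z d.

Lemma ex_C_derive_const (c z : C) : ex_C_derive (fun _ => c) z.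
Proof.
  eexists; apply is_C_derive_iff.
  apply (is_derive_const (K := C_AbsRing) (V := AbsRing_NormedModule C_AbsRing)).
Qed.

Lemma ex_C_derive_id (z : C) : ex_C_derive (fun w => w) z.
Proof.
  eexists; apply is_C_derive_iff.
  apply (is_derive_id (K := C_AbsRing)).
Qed.

Lemma ex_C_derive_plus (f g : C -> C) (z : C) :
  ex_C_derive f z -> ex_C_derive g z -> ex_C_derive (fun w => f w + g w)%C z.
Proof.
  intros [df Hf] [dg Hg]; eexists; apply is_C_derive_iff.
  apply (is_derive_plus (K := C_AbsRing) (V := AbsRing_NormedModule C_AbsRing));
    apply is_C_derive_iff; eassumption.
Qed.

Lemma ex_C_derive_mult (f g : C -> C) (z : C) :
  ex_C_derive f z -> ex_C_derive g z -> ex_C_derive (fun w => f w * g w)%C z.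
Proof.
  intros [df Hf] [dg Hg]; eexists; apply is_C_derive_iff.
  apply (is_derive_mult (K := C_AbsRing)).
  - apply is_C_derive_iff; eassumption.
  - apply is_C_derive_iff; eassumption.
  - exact Cmult_comm.
Qed.

Lemma ex_C_derive_comp (f g : C -> C) (z : C) :
  ex_C_derive f (g z) -> ex_C_derive g z -> ex_C_derive (fun w => f (g w)) z.
Proof.
  intros [df Hf] [dg Hg]; eexists; apply is_C_derive_iff.
  apply (is_derive_comp (K := C_AbsRing) (V := AbsRing_NormedModule C_AbsRing) f g).
  - apply is_C_derive_iff; eassumption.
  - apply is_C_derive_iff; eassumption.
Qed.

Lemma is_C_derive_of_quadratic (f : C -> C) (z d : C) (K r : R) : 0 < r ->
  (forall w, Cmod (w - z) < r -> Cmod (f w - f z - (w - z) * d) <= K * (Cmod (w - z)) ^ 2) ->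
  is_C_derive f z d.
Proof.
  intros Hr H e He.
  assert (HK : 0 < Rabs K + 1) by (generalize (Rabs_pos K); lra).
  exists (Rmin r (e / (Rabs K + 1))); split.
  - apply Rmin_glb_lt; [exact Hr | now apply Rdiv_lt_0_compat].
  - intros w Hw.
    assert (H1 := H w (Rlt_le_trans _ _ _ Hw (Rmin_l _ _))).
    assert (H2 := Rlt_le_trans _ _ _ Hw (Rmin_r _ _)).
    assert (P := Cmod_ge_0 (w - z)).
    assert (H3 : Cmod (w - z) * (Rabs K + 1) <= e).
    { apply Rmult_le_reg_r with (/ (Rabs K + 1)); [now apply Rinv_0_lt_compat|].
      rewrite Rmult_assoc, Rinv_r by lra; unfold Rdiv in H2; lra. }
    apply Rle_trans with (1 := H1).
    generalize (Rle_abs K); intros HK'; simpl; nra.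
Qed.

(** The remainder is exactly (w-z)^2 / (w z^2), and |w| > |z|/2 near z. *)
Lemma ex_C_derive_inv (z : C) : z <> RtoC 0 -> ex_C_derive Cinv z.
Proof.
  intros Hz; assert (Hm : 0 < Cmod z) by now apply Cmod_gt_0.
  exists (- (/ (z * z)))%C.
  apply is_C_derive_of_quadratic with (2 * / Cmod z ^ 3) (Cmod z / 2); [lra|].
  intros w Hw.
  assert (Hw1 : Cmod z / 2 < Cmod w).
  { assert (T := Cmod_triangle w (z - w)).
    replace (w + (z - w))%C with z in T by ring.
    replace (z - w)%C with (- (w - z))%C in T by ring; rewrite Cmod_opp in T; lra. }
  assert (Hw0 : w <> RtoC 0) by (apply Cmod_gt_0; lra).
  replace (/ w - / z - (w - z) * - / (z * z))%C with ((w - z) * (w - z) * / (w * (z * z)))%C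
    by (field; auto).
  rewrite !Cmod_mult, Cmod_inv by (repeat apply Cmult_neq_0; assumption).
  rewrite !Cmod_mult.
  replace (Cmod (w - z) * Cmod (w - z) * / (Cmod w * (Cmod z * Cmod z)))
    with (/ Cmod w * / (Cmod z * Cmod z) * Cmod (w - z) ^ 2) by (field; lra).
  apply Rmult_le_compat_r; [apply pow2_ge_0|].
  replace (2 * / Cmod z ^ 3) with (/ (Cmod z / 2) * / (Cmod z * Cmod z)) by (field; lra).
  apply Rmult_le_compat_r.
  - apply Rlt_le, Rinv_0_lt_compat, Rmult_lt_0_compat; exact Hm.
  - apply Rinv_le_contravar; lra.
Qed.

Lemma ex_C_derive_nonzero_near (f : C -> C) (z : C) : ex_C_derive f z -> f z <> RtoC 0 ->
  exists r, 0 < r /\ forall w, Cmod (w - z) < r -> f w <> RtoC 0.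
Proof.
  intros [d Hd] H0; assert (Hm : 0 < Cmod (f z)) by now apply Cmod_gt_0.
  destruct (Hd 1 Rlt_0_1) as [r [Hr H]].
  assert (HK : 0 < 1 + Cmod d) by (generalize (Cmod_ge_0 d); lra).
  exists (Rmin r (Cmod (f z) / (1 + Cmod d))); split.
  - apply Rmin_glb_lt; [exact Hr | now apply Rdiv_lt_0_compat].
  - intros w Hw E.
    assert (H1 := H w (Rlt_le_trans _ _ _ Hw (Rmin_l _ _))).
    assert (H2 := Rlt_le_trans _ _ _ Hw (Rmin_r _ _)).
    (* If f(w) = 0, the first-order expansion gives |f(z)| <= (1 + |d|) |w - z|, contrary to the
       choice of the radius. *)
    rewrite E in H1.
    assert (T := Cmod_triangle (0 - f z - (w - z) * d) ((w - z) * d)).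
    replace (0 - f z - (w - z) * d + (w - z) * d)%C with (- f z)%C in T by ring.
    rewrite Cmod_opp, Cmod_mult in T.
    apply (Rmult_lt_compat_r (1 + Cmod d)) in H2; [|exact HK].
    unfold Rdiv in H2; rewrite Rmult_assoc, Rinv_l in H2 by lra; nra.
Qed.

Lemma holomorphic_at_of_ex_C_derive (f : C -> C) (z : C) (r : R) : 0 < r ->
  (forall w, Cmod (w - z) < r -> ex_C_derive f w) -> holomorphic_at f z.
Proof.
  intros Hr H; unfold holomorphic_at.
  apply (proj2 (locally_C z _)).
  exists (mkposreal r Hr); intros w Hw.
  destruct (H w Hw) as [d Hd]; exists d; now apply is_C_derive_is_derive.
Qed.

Lemma pole_of_order_1_intro (f g : C -> C) (z : C) (r : R) : 0 < r ->
  (forall w, Cmod (w - z) < r -> ex_C_derive g w) -> g z <> RtoC 0 ->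
  (forall w, Cmod (w - z) < r -> w <> z -> f w = g w * / (w - z))%C ->
  pole_of_order 1 f z.
Proof.
  intros Hr Hg H0 Hf; split; [lia|].
  exists g; split; [now apply holomorphic_at_of_ex_C_derive with r | split; [exact H0|]].
  unfold locally', within; apply (proj2 (locally_C z _)).
  exists (mkposreal r Hr); intros w Hw Hwz.
  rewrite (Hf w Hw Hwz); unfold Cdiv; f_equal; f_equal; simpl; ring.
Qed.

(** * Second-order bounds and differentiability of the complex exponential *)

Lemma sin_abs_le (x : R) : Rabs (sin x) <= Rabs x.
Proof.
  assert (H : forall y, 0 <= y -> Rabs (sin y) <= y).
  { intros y Hy; apply Rabs_le; split.
    - destruct (Rle_lt_dec y PI) as [H|H].
      + generalize (sin_ge_0 y Hy H); lra.
      + generalize (proj1 (SIN_bound y)) PI2_1; lra.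
    - destruct Hy as [Hy|<-]; [now apply Rlt_le, sin_lt_x | rewrite sin_0; lra]. }
  destruct (Rle_lt_dec 0 x) as [Hx|Hx].
  - rewrite (Rabs_right x) by lra; now apply H.
  - rewrite <- Rabs_Ropp, <- sin_neg, (Rabs_left x) by exact Hx; apply H; lra.
Qed.

Lemma one_minus_cos_le (x : R) : 0 <= 1 - cos x <= x ^ 2 / 2.
Proof.
  split; [generalize (proj2 (COS_bound x)); lra|].
  replace x with (2 * (x / 2)) at 1 by field.
  rewrite cos_2a_sin.
  assert (H := sin_abs_le (x / 2)).
  assert (H2 := pow_incr _ _ 2 (conj (Rabs_pos _) H)).
  rewrite !pow2_abs in H2; simpl in *; nra.
Qed.

Lemma sin_minus_id_le (y : R) : Rabs (sin y - y) <= y ^ 2.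
Proof.
  destruct (MVT_gen (fun t => sin t - t) 0 y (fun t => cos t - 1)) as [c [Hc E]].
  - intros x _; auto_derive; [exact I|ring].
  - intros x _; apply continuity_pt_filterlim.
    apply (ex_derive_continuous (K := R_AbsRing) (V := R_NormedModule) (fun t => sin t - t)).
    auto_derive; exact I.
  - rewrite sin_0, !Rminus_0_r in E; rewrite E, Rabs_mult.
    assert (Hcy : Rabs c <= Rabs y).
    { unfold Rmin, Rmax in Hc; destruct (Rle_dec 0 y); unfold Rabs; repeat destruct Rcase_abs; lra. }
    assert (Hcc : Rabs (cos c - 1) <= Rabs c).
    { assert (B := one_minus_cos_le c); rewrite Rabs_left1 by lra.
      rewrite <- (pow2_abs c) in B; generalize (Rabs_pos c) (proj1 (COS_bound c)); intros; simpl in *; nra. }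
    rewrite <- (pow2_abs y); generalize (Rabs_pos y) (Rabs_pos (cos c - 1)); intros; simpl; nra.
Qed.

Lemma exp_minus_1_le (x : R) : Rabs (exp x - 1) <= Rabs x * exp (Rabs x).
Proof.
  assert (A := exp_ineq1_le x); assert (B := exp_ineq1_le (- x)).
  assert (P := exp_pos x).
  assert (E : exp x * exp (- x) = 1) by (rewrite <- exp_plus, <- exp_0; f_equal; ring).
  destruct (Rle_lt_dec 0 x) as [Hx|Hx].
  - rewrite (Rabs_right x), Rabs_right by lra; nra.
  - rewrite (Rabs_left x), Rabs_left1 by nra.
    assert (1 <= exp (- x)) by lra; nra.
Qed.

Lemma exp_minus_1_minus_id_le (x : R) : Rabs (exp x - 1 - x) <= x ^ 2 * exp (Rabs x).
Proof.
  assert (A := exp_ineq1_le x); assert (B := exp_ineq1_le (- x)).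
  assert (P := exp_pos x).
  assert (E : exp x * exp (- x) = 1) by (rewrite <- exp_plus, <- exp_0; f_equal; ring).
  assert (H : exp x - 1 <= x * exp x) by nra.
  rewrite Rabs_right by lra; apply Rle_trans with (x * (exp x - 1)); [nra|].
  apply Rle_trans with (1 := Rle_abs _); rewrite Rabs_mult.
  assert (H1 := exp_minus_1_le x); rewrite <- pow2_abs.
  generalize (Rabs_pos x); intros; simpl; nra.
Qed.

Lemma Cmod_le_Rabs (z : C) : Cmod z <= Rabs (fst z) + Rabs (snd z).
Proof.
  replace z with (RtoC (fst z) + RtoC (snd z) * Ci)%C at 1
    by (destruct z; unfold RtoC, Ci, Cplus, Cmult; simpl; f_equal; ring).
  apply Rle_trans with (1 := Cmod_triangle _ _).
  rewrite Cmod_mult, Cmod_Ci, !Cmod_R; lra.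
Qed.

Lemma Cmod_cexp (z : C) : Cmod (cexp z) = exp (Re z).
Proof.
  unfold cexp.
  replace (exp (Re z) * cos (Im z), exp (Re z) * sin (Im z))
    with (RtoC (exp (Re z)) * (cos (Im z), sin (Im z)))%C
    by (unfold RtoC, Cmult; simpl; f_equal; ring).
  rewrite Cmod_mult, Cmod_R, Rabs_right by (apply Rle_ge, Rlt_le, exp_pos).
  unfold Cmod; simpl.
  replace (cos (Im z) * (cos (Im z) * 1) + sin (Im z) * (sin (Im z) * 1)) with 1
    by (generalize (sin2_cos2 (Im z)); unfold Rsqr; lra).
  rewrite sqrt_1; ring.
Qed.

Lemma cexp_plus (z w : C) : cexp (z + w) = (cexp z * cexp w)%C.
Proof.
  unfold cexp, Cmult, Cplus, Re, Im; simpl.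
  rewrite exp_plus, cos_plus, sin_plus; f_equal; ring.
Qed.

Lemma cexp_0 : cexp (RtoC 0) = RtoC 1.
Proof. unfold cexp, RtoC; simpl; rewrite exp_0, cos_0, sin_0; f_equal; ring. Qed.

Lemma cexp_RtoC (x : R) : cexp (RtoC x) = RtoC (exp x).
Proof. unfold cexp, RtoC; simpl; rewrite cos_0, sin_0; f_equal; ring. Qed.

Lemma cexp_neq_0 (z : C) : cexp z <> RtoC 0.
Proof. apply Cmod_gt_0; rewrite Cmod_cexp; apply exp_pos. Qed.

Lemma Cmod_cexp_le (z : C) : Cmod (cexp z) <= exp (Cmod z).
Proof.
  rewrite Cmod_cexp; apply exp_le_compat, Rle_trans with (1 := Rle_abs _), re_le_Cmod.
Qed.

(** The constant 4 counts error terms: two in the real part and two in the imaginary part, each at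
    most e^{|z|} |z|^2. *)
Lemma Cmod_cexp_minus_1_minus_id_le (z : C) :
  Cmod (cexp z - 1 - z) <= 4 * exp (Cmod z) * Cmod z ^ 2.
Proof.
  destruct z as [x y].
  assert (Hx : Rabs x <= Cmod (x, y)) by apply (re_le_Cmod (x, y)).
  assert (Hy : Rabs y <= Cmod (x, y)).
  { apply Rle_trans with (2 := Rmax_Cmod (x, y)); apply Rmax_r. }
  set (r := Cmod (x, y)) in *; set (M := exp r).
  assert (Px := Rabs_pos x); assert (Py := Rabs_pos y).
  assert (HM : exp (Rabs x) <= M) by now apply exp_le_compat.
  assert (HM1 : exp x <= M) by (apply exp_le_compat; generalize (Rle_abs x); lra).
  assert (P := exp_pos x).
  apply Rle_trans with (1 := Cmod_le_Rabs _); simpl.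
  replace (exp x * cos y + - (1) + - x) with ((exp x - 1 - x) + - (exp x * (1 - cos y))) by ring.
  replace (exp x * sin y + - 0 + - y) with (exp x * (sin y - y) + (exp x - 1) * y) by ring.
  assert (E1 : Rabs (exp x - 1 - x) <= M * r ^ 2).
  { apply Rle_trans with (1 := exp_minus_1_minus_id_le x).
    rewrite <- pow2_abs, Rmult_comm; apply Rmult_le_compat; try (apply Rlt_le, exp_pos); try apply pow2_ge_0; [exact HM|].
    now apply pow_incr. }
  assert (E2 : Rabs (- (exp x * (1 - cos y))) <= M * r ^ 2).
  { assert (B := one_minus_cos_le y).
    rewrite Rabs_Ropp, Rabs_mult, (Rabs_right (exp x)), Rabs_right by lra.
    apply Rmult_le_compat; try lra.
    rewrite <- (pow2_abs y) in B; assert (Rabs y ^ 2 <= r ^ 2) by now apply pow_incr. lra. }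
  assert (E3 : Rabs (exp x * (sin y - y)) <= M * r ^ 2).
  { rewrite Rabs_mult, (Rabs_right (exp x)) by lra.
    apply Rmult_le_compat; try lra; [apply Rabs_pos|].
    apply Rle_trans with (1 := sin_minus_id_le y); rewrite <- pow2_abs; now apply pow_incr. }
  assert (E4 : Rabs ((exp x - 1) * y) <= M * r ^ 2).
  { rewrite Rabs_mult.
    apply Rle_trans with ((Rabs x * exp (Rabs x)) * Rabs y).
    - apply Rmult_le_compat_r; [exact Py | apply exp_minus_1_le].
    - replace (M * r ^ 2) with ((r * M) * r) by ring.
      apply Rmult_le_compat; try lra.
      + apply Rmult_le_pos; [exact Px | apply Rlt_le, exp_pos].
      + apply Rmult_le_compat; try lra; apply Rlt_le, exp_pos. }
  generalize (Rabs_triang (exp x - 1 - x) (- (exp x * (1 - cos y))))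
    (Rabs_triang (exp x * (sin y - y)) ((exp x - 1) * y)); simpl in *; lra.
Qed.

Lemma ex_C_derive_cexp (z : C) : ex_C_derive cexp z.
Proof.
  exists (cexp z); apply is_C_derive_of_quadratic with (Cmod (cexp z) * (4 * exp 1)) 1; [lra|].
  intros w Hw.
  replace w with (z + (w - z))%C at 1 by ring; rewrite cexp_plus.
  replace (cexp z * cexp (w - z) - cexp z - (w - z) * cexp z)%C
    with (cexp z * (cexp (w - z) - 1 - (w - z)))%C by ring.
  rewrite Cmod_mult, Rmult_assoc; apply Rmult_le_compat_l; [apply Cmod_ge_0|].
  apply Rle_trans with (1 := Cmod_cexp_minus_1_minus_id_le _).
  apply Rmult_le_compat_r; [apply pow2_ge_0|].
  apply Rmult_le_compat_l; [lra|]. apply exp_le_compat; lra.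
Qed.

(** * The Weierstrass product *)

Definition is_C_lim (u : nat -> C) (l : C) : Prop :=
  is_lim_seq (fun n => Cmod (u n - l)) 0.

Lemma is_lim_seq_squeeze_0 (u v : nat -> R) :
  (forall n, 0 <= u n <= v n) -> is_lim_seq v 0 -> is_lim_seq u 0.
Proof. intros H Hv; exact (is_lim_seq_le_le _ _ _ _ H (is_lim_seq_const 0) Hv). Qed.

Lemma is_lim_seq_Rabs_minus (u : nat -> R) (l : R) :
  is_lim_seq u l -> is_lim_seq (fun n => Rabs (u n - l)) 0.
Proof.
  intros H; apply (proj1 (is_lim_seq_abs_0 _)); replace 0 with (l - l) by ring.
  apply is_lim_seq_minus'; [exact H | apply is_lim_seq_const].
Qed.

Lemma is_C_lim_const (c : C) : is_C_lim (fun _ => c) c.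
Proof.
  unfold is_C_lim; apply is_lim_seq_ext with (fun _ => 0); [|apply is_lim_seq_const].
  intros _; replace (c - c)%C with (RtoC 0) by ring; symmetry; apply Cmod_0.
Qed.

Lemma is_C_lim_ext (u v : nat -> C) (l : C) : (forall n, u n = v n) -> is_C_lim u l -> is_C_lim v l.
Proof. intros H; apply is_lim_seq_ext; intros n; now rewrite H. Qed.

Lemma is_C_lim_RtoC (u : nat -> R) (l : R) : is_lim_seq u l -> is_C_lim (fun n => RtoC (u n)) (RtoC l).
Proof.
  intros H; unfold is_C_lim; apply is_lim_seq_ext with (fun n => Rabs (u n - l)).
  - intros n; rewrite <- Cmod_R, RtoC_minus; reflexivity.
  - now apply is_lim_seq_Rabs_minus.
Qed.

Lemma is_C_lim_plus (u v : nat -> C) (l m : C) :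
  is_C_lim u l -> is_C_lim v m -> is_C_lim (fun n => u n + v n)%C (l + m)%C.
Proof.
  intros Hu Hv; apply (is_lim_seq_squeeze_0 _ (fun n => Cmod (u n - l) + Cmod (v n - m))).
  - intros n; split; [apply Cmod_ge_0|].
    replace (u n + v n - (l + m))%C with ((u n - l) + (v n - m))%C by ring; apply Cmod_triangle.
  - replace 0 with (0 + 0) by ring.
    now apply is_lim_seq_plus'.
Qed.

Lemma is_C_lim_mult (u v : nat -> C) (l m : C) :
  is_C_lim u l -> is_C_lim v m -> is_C_lim (fun n => u n * v n)%C (l * m)%C.
Proof.
  intros Hu Hv.
  apply (is_lim_seq_squeeze_0 _ (fun n => Cmod (u n - l) * Cmod (v n - m) + (Cmod l * Cmod (v n - m) + Cmod m * Cmod (u n - l)))).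
  - intros n; split; [apply Cmod_ge_0|].
    replace (u n * v n - l * m)%C with ((u n - l) * (v n - m) + (l * (v n - m) + m * (u n - l)))%C by ring.
    rewrite <- !Cmod_mult; apply Rle_trans with (1 := Cmod_triangle _ _).
    apply Rplus_le_compat_l, Cmod_triangle.
  - replace 0 with (0 * 0 + (Cmod l * 0 + Cmod m * 0)) by ring.
    apply is_lim_seq_plus'; [now apply is_lim_seq_mult'|].
    apply is_lim_seq_plus'; apply is_lim_seq_mult'; try assumption; apply is_lim_seq_const.
Qed.

Lemma is_C_lim_minus (u v : nat -> C) (l m : C) :
  is_C_lim u l -> is_C_lim v m -> is_C_lim (fun n => u n - v n)%C (l - m)%C.
Proof.
  intros Hu Hv.
  apply is_C_lim_ext with (fun n => u n + - RtoC 1 * v n)%C; [intros n; ring|].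
  replace (l - m)%C with (l + - RtoC 1 * m)%C by ring.
  apply is_C_lim_plus; [exact Hu|]; apply is_C_lim_mult; [apply is_C_lim_const | exact Hv].
Qed.

Lemma is_lim_seq_Cmod (u : nat -> C) (l : C) : is_C_lim u l -> is_lim_seq (fun n => Cmod (u n)) (Cmod l).
Proof.
  intros H.
  rewrite <- (Rplus_0_l (Cmod l)).
  apply is_lim_seq_ext with (fun n => (Cmod (u n) - Cmod l) + Cmod l); [intros n; ring|].
  apply is_lim_seq_plus'; [|apply is_lim_seq_const].
  apply (proj2 (is_lim_seq_abs_0 _)); refine (is_lim_seq_squeeze_0 _ _ _ H); intros n; split; [apply Rabs_pos|].
  apply Rabs_le; assert (A := Cmod_triangle (u n - l) l); assert (B := Cmod_triangle (l - u n) (u n)).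
  replace (u n - l + l)%C with (u n) in A by ring.
  replace (l - u n + u n)%C with l in B by ring.
  replace (l - u n)%C with (- (u n - l))%C in B by ring; rewrite Cmod_opp in B; lra.
Qed.

Lemma is_C_lim_le (u : nat -> C) (l : C) (B : R) : is_C_lim u l -> (forall n, Cmod (u n) <= B) -> Cmod l <= B.
Proof.
  intros H HB; exact (is_lim_seq_le _ _ (Cmod l) B HB (is_lim_seq_Cmod _ _ H) (is_lim_seq_const B)).
Qed.

Lemma is_C_lim_eq (u : nat -> C) (l m : C) : is_C_lim u l -> is_C_lim u m -> l = m.
Proof.
  intros Hl Hm.
  assert (H := is_C_lim_minus _ _ _ _ Hl Hm).
  apply is_C_lim_le with (B := 0) in H.
  - assert (E : (l - m)%C = RtoC 0) by (apply Cmod_eq_0, Rle_antisym; [exact H | apply Cmod_ge_0]).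
    replace l with ((l - m) + m)%C by ring; rewrite E; ring.
  - intros n; replace (u n - u n)%C with (RtoC 0) by ring; rewrite Cmod_0; lra.
Qed.

(** * Sequences whose increments are O(1/n^2) *)

Definition C_Lim (u : nat -> C) : C :=
  (real (Lim_seq (fun n => fst (u n))), real (Lim_seq (fun n => snd (u n)))).

(** A telescoping majorant makes tail sums explicit. It serves the Cauchy criterion, the uniform
    bound on the partial products and the lower bound that keeps the limit from vanishing. *)
Lemma inv_square_le (n : nat) :
  / (INR n + 1) ^ 2 <= 2 * (/ (INR n + 1) - / (INR n + 2)).
Proof.
  assert (Hn := pos_INR n).
  replace (/ (INR n + 1) - / (INR n + 2)) with (/ ((INR n + 1) * (INR n + 2))) by (field; lra).
  apply Rmult_le_reg_r with ((INR n + 1) ^ 2 * (INR n + 2)).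
  { apply Rmult_lt_0_compat; [apply pow_lt|]; lra. }
  replace (/ (INR n + 1) ^ 2 * ((INR n + 1) ^ 2 * (INR n + 2))) with (INR n + 2) by (field; lra).
  replace (2 * / ((INR n + 1) * (INR n + 2)) * ((INR n + 1) ^ 2 * (INR n + 2))) with (2 * (INR n + 1)) by (field; lra).
  lra.
Qed.

Lemma ex_finite_lim_seq_inv_square (u : nat -> R) (K : R) :
  (forall n, Rabs (u (S n) - u n) <= K / (INR n + 1) ^ 2) -> ex_finite_lim_seq u.
Proof.
  intros H.
  assert (HK : 0 <= K).
  { generalize (Rle_trans _ _ _ (Rabs_pos _) (H O)); simpl; unfold Rdiv; rewrite Rplus_0_l, !Rmult_1_r, Rinv_1; lra. }
  assert (B : forall n k, Rabs (u (n + k)%nat - u n) <= 2 * K * (/ (INR n + 1) - / (INR (n + k) + 1))).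
  { intros n; induction k as [|k IH].
    - rewrite Nat.add_0_r; unfold Rminus; rewrite !Rplus_opp_r, Rabs_R0; lra.
    - rewrite Nat.add_succ_r.
      replace (u (S (n + k)) - u n) with ((u (S (n + k)) - u (n + k)%nat) + (u (n + k)%nat - u n)) by ring.
      apply Rle_trans with (1 := Rabs_triang _ _).
      assert (A := H (n + k)%nat); assert (C := inv_square_le (n + k)).
      apply (Rmult_le_compat_l K) in C; [|exact HK].
      rewrite S_INR; replace (INR (n + k) + 1 + 1) with (INR (n + k) + 2) by ring.
      unfold Rdiv in A; lra. }
  apply ex_lim_seq_cauchy_corr; intros e.
  destruct (INR_unbounded (2 * K / (e / 2))) as [N HN].
  assert (HN' : forall n, (N <= n)%nat -> 2 * K * / (INR n + 1) < e / 2).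
  { intros n Hn; apply le_INR in Hn; assert (Pn := pos_INR n).
    apply Rmult_lt_reg_r with (INR n + 1); [lra|].
    rewrite Rmult_assoc, Rinv_l by lra.
    apply (Rmult_lt_compat_r (e / 2)) in HN; [|generalize (cond_pos e); lra].
    unfold Rdiv at 1 in HN; rewrite Rmult_assoc, Rinv_l in HN by (generalize (cond_pos e); lra).
    generalize (cond_pos e); intros; nra. }
  exists N; intros n m Hn Hm.
  assert (D : forall n, (N <= n)%nat -> Rabs (u n - u N) < e / 2).
  { intros k Hk; replace k with (N + (k - N))%nat by lia.
    apply Rle_lt_trans with (1 := B _ _).
    apply Rle_lt_trans with (2 := HN' N (le_n N)); apply Rmult_le_compat_l; [lra|].
    assert (0 < / (INR (N + (k - N)) + 1)) by (apply Rinv_0_lt_compat; generalize (pos_INR (N + (k - N))); lra).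
    lra. }
  replace (u n - u m) with ((u n - u N) + - (u m - u N)) by ring.
  apply Rle_lt_trans with (1 := Rabs_triang _ _); rewrite Rabs_Ropp.
  generalize (D n Hn) (D m Hm); lra.
Qed.

Lemma C_Lim_correct_inv_square (u : nat -> C) (K : R) :
  (forall n, Cmod (u (S n) - u n) <= K / (INR n + 1) ^ 2) -> is_C_lim u (C_Lim u).
Proof.
  intros H.
  assert (H1 : ex_finite_lim_seq (fun n => fst (u n))).
  { apply ex_finite_lim_seq_inv_square with K; intros n; apply Rle_trans with (2 := H n).
    exact (re_le_Cmod (u (S n) - u n)%C). }
  assert (H2 : ex_finite_lim_seq (fun n => snd (u n))).
  { apply ex_finite_lim_seq_inv_square with K; intros n; apply Rle_trans with (2 := H n).
    apply Rle_trans with (2 := Rmax_Cmod (u (S n) - u n)%C); apply Rmax_r. }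
  apply Lim_seq_correct' in H1, H2.
  apply (is_lim_seq_squeeze_0 _ (fun n => Rabs (fst (u n) - fst (C_Lim u)) + Rabs (snd (u n) - snd (C_Lim u)))).
  - intros n; split; [apply Cmod_ge_0|]. exact (Cmod_le_Rabs (u n - C_Lim u)%C).
  - replace 0 with (0 + 0) by ring.
    apply is_lim_seq_plus'; now apply is_lim_seq_Rabs_minus.
Qed.

(* Differentiability on the disc of radius [rho] with derivative [d], in a
   quantitative form that is closed under products and pointwise limits, so
   that no theorem on uniform limits of holomorphic functions is needed. *)
Definition C_jet (rho : R) (f d : C -> C) (M : R) : Prop :=
  forall z w : C, Cmod z <= rho -> Cmod w <= rho ->
    Cmod (f z) <= M /\ Cmod (d z) <= M /\
    Cmod (f w - f z - (w - z) * d z) <= M * Cmod (w - z) ^ 2.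

Lemma C_jet_ge_0 (rho : R) (f d : C -> C) (M : R) : 0 <= rho -> C_jet rho f d M -> 0 <= M.
Proof.
  intros Hr H; destruct (H (RtoC 0) (RtoC 0)) as [H1 _]; try (rewrite Cmod_0; exact Hr).
  apply Rle_trans with (2 := H1), Cmod_ge_0.
Qed.

Lemma C_jet_is_C_derive (rho : R) (f d : C -> C) (M : R) (z : C) :
  C_jet rho f d M -> Cmod z < rho -> is_C_derive f z (d z).
Proof.
  intros H Hz; apply is_C_derive_of_quadratic with M (rho - Cmod z); [lra|].
  intros w Hw; apply H; [lra|].
  replace w with (z + (w - z))%C by ring; generalize (Cmod_triangle z (w - z)); lra.
Qed.

(** In the remainder of the product with h = w - z, the terms h^2 d v', r_f v(w) and f r_v each
    contribute M c |h|^2, and h d r_v contributes 2 rho M c |h|^2 because |h| <= 2 rho. Hence 3 + 2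
    rho. *)
Lemma C_jet_mult_1_plus (rho : R) (f d v v' : C -> C) (M c : R) : 0 <= rho ->
  C_jet rho f d M -> C_jet rho v v' c ->
  C_jet rho (fun z => f z * (1 + v z))%C (fun z => d z * (1 + v z) + f z * v' z)%C
    (M * (1 + (3 + 2 * rho) * c)).
Proof.
  intros Hr Hf Hv.
  assert (HM := C_jet_ge_0 _ _ _ _ Hr Hf); assert (Hc := C_jet_ge_0 _ _ _ _ Hr Hv).
  intros z w Hz Hw.
  destruct (Hf z w Hz Hw) as [F1 [F2 F3]]; destruct (Hv z w Hz Hw) as [V1 [V2 V3]].
  destruct (Hv w w Hw Hw) as [V1w _].
  assert (Mc : 0 <= M * c) by now apply Rmult_le_pos.
  assert (Mcr : 0 <= M * c * rho) by now apply Rmult_le_pos.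
  assert (mul : forall a b x y, Cmod a <= x -> Cmod b <= y -> Cmod (a * b) <= x * y).
  { intros a b x y Ha Hb; rewrite Cmod_mult; apply Rmult_le_compat; try apply Cmod_ge_0; assumption. }
  assert (fv := mul _ _ _ _ F1 V1); assert (dv := mul _ _ _ _ F2 V1); assert (fv' := mul _ _ _ _ F1 V2).
  split; [|split].
  - replace (f z * (1 + v z))%C with (f z + f z * v z)%C by ring.
    apply Rle_trans with (1 := Cmod_triangle _ _); nra.
  - replace (d z * (1 + v z) + f z * v' z)%C with (d z + (d z * v z + f z * v' z))%C by ring.
    apply Rle_trans with (1 := Cmod_triangle _ _).
    generalize (Cmod_triangle (d z * v z) (f z * v' z)); nra.
  - set (h := (w - z)%C) in *.
    set (rf := (f w - f z - h * d z)%C) in *; set (rv := (v w - v z - h * v' z)%C) in *.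
    replace (f w * (1 + v w) - f z * (1 + v z) - h * (d z * (1 + v z) + f z * v' z))%C
      with (rf + (h * h * (d z * v' z) + (rf * v w + (f z * rv + h * (d z * rv)))))%C
      by (unfold rf, rv; ring).
    assert (T0 : Cmod h <= 2 * rho).
    { unfold h, Cminus; generalize (Cmod_triangle w (- z)); rewrite Cmod_opp; lra. }
    assert (T1 := mul _ _ _ _ F2 V2).
    assert (T2 := mul _ _ _ _ F3 V1w).
    assert (T3 := mul _ _ _ _ F1 V3).
    assert (T4 := mul _ _ _ _ T0 (mul _ _ _ _ F2 V3)).
    assert (T5 := mul _ _ _ _ (mul h h _ _ (Rle_refl _) (Rle_refl _)) T1).
    apply Rle_trans with (M * Cmod h ^ 2 + (Cmod h * Cmod h * (M * c) + (M * Cmod h ^ 2 * c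
       + (M * (c * Cmod h ^ 2) + 2 * rho * (M * (c * Cmod h ^ 2)))))); [|right; ring].
    apply Rle_trans with (1 := Cmod_triangle _ _); apply Rplus_le_compat; [exact F3|].
    apply Rle_trans with (1 := Cmod_triangle _ _); apply Rplus_le_compat; [exact T5|].
    apply Rle_trans with (1 := Cmod_triangle _ _); apply Rplus_le_compat; [exact T2|].
    apply Rle_trans with (1 := Cmod_triangle _ _); apply Rplus_le_compat; [exact T3|exact T4].
Qed.

Lemma C_jet_lim (rho : R) (f d : nat -> C -> C) (g h : C -> C) (M : R) :
  (forall n, C_jet rho (f n) (d n) M) ->
  (forall z, is_C_lim (fun n => f n z) (g z)) -> (forall z, is_C_lim (fun n => d n z) (h z)) ->
  C_jet rho g h M.
Proof.
  intros H Hf Hd z w Hz Hw; split; [|split].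
  - apply (is_C_lim_le _ _ _ (Hf z)); intros n; now apply (H n z w).
  - apply (is_C_lim_le _ _ _ (Hd z)); intros n; now apply (H n z w).
  - apply is_C_lim_le with (fun n => f n w - f n z - (w - z) * d n z)%C.
    + apply is_C_lim_minus; [now apply is_C_lim_minus|].
      apply is_C_lim_mult; [apply is_C_lim_const | apply Hd].
    + intros n; now apply (H n z w).
Qed.

(** The Weierstrass factor (1+z) e^{-z} minus 1. The exponential makes it vanish to second order at
    0, which is what lets the product converge. *)
Definition weier (z : C) : C := ((1 + z) * cexp (- z) - 1)%C.
Definition weier' (z : C) : C := (- z * cexp (- z))%C.

Lemma weier_bounds (rho : R) : 0 <= rho -> exists K, 0 <= K /\ forall z w, Cmod z <= rho -> Cmod w <= rho ->
  Cmod (weier z) <= K * Cmod z ^ 2 /\ Cmod (weier' z) <= K * Cmod z /\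
  Cmod (weier w - weier z - (w - z) * weier' z) <= K * Cmod (w - z) ^ 2.
Proof.
  intros Hr.
  pose (E := 4 * exp (2 * rho)); pose (A := 1 + (1 + rho) * E).
  assert (HE : 1 <= exp (2 * rho)) by (rewrite <- exp_0; apply exp_le_compat; lra).
  assert (HA : 1 <= A) by (unfold A, E; nra).
  assert (HE0 : 0 <= E) by (unfold E; lra).
  assert (R : forall h, Cmod h <= 2 * rho -> Cmod (cexp (- h) - 1 + h) <= E * Cmod h ^ 2).
  { intros h Hh; replace (cexp (- h) - 1 + h)%C with (cexp (- h) - 1 - (- h))%C by ring.
    apply Rle_trans with (1 := Cmod_cexp_minus_1_minus_id_le _); rewrite Cmod_opp.
    apply Rmult_le_compat_r; [apply pow2_ge_0|]; unfold E.
    apply Rmult_le_compat_l; [lra|]; now apply exp_le_compat. }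
  (* Apart from a factor e^{-z}, the remainder at w = z + h is -h^2 + (1+w)(e^{-h} - 1 + h). The
     same expression with both arguments equal to z is [weier z], so one bound serves twice. *)
  assert (P : forall z h, Cmod z <= rho -> Cmod h <= 2 * rho ->
    Cmod (- (h * h) + (1 + z) * (cexp (- h) - 1 + h)) <= A * Cmod h ^ 2).
  { intros z h Hz Hh; apply Rle_trans with (1 := Cmod_triangle _ _).
    rewrite Cmod_opp, !Cmod_mult.
    assert (T := Cmod_triangle 1 z); rewrite Cmod_1 in T.
    replace (A * Cmod h ^ 2) with (Cmod h * Cmod h + (1 + rho) * (E * Cmod h ^ 2)) by (unfold A; ring).
    apply Rplus_le_compat_l, Rmult_le_compat; try apply Cmod_ge_0; [lra | now apply R]. }
  assert (Q : forall z, Cmod z <= rho -> Cmod (cexp (- z)) <= E).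
  { intros z Hz; apply Rle_trans with (1 := Cmod_cexp_le _); rewrite Cmod_opp; unfold E.
    assert (exp (Cmod z) <= exp (2 * rho)) by (apply exp_le_compat; lra); lra. }
  exists (A * (1 + E)); split; [nra|]; intros z w Hz Hw; split; [|split].
  - unfold weier.
    replace ((1 + z) * cexp (- z) - 1)%C with (- (z * z) + (1 + z) * (cexp (- z) - 1 + z))%C by ring.
    apply Rle_trans with (A * Cmod z ^ 2); [apply P; lra|].
    apply Rmult_le_compat_r; [apply pow2_ge_0 | nra].
  - unfold weier'; rewrite Cmod_mult, Cmod_opp, Rmult_comm.
    apply Rmult_le_compat_r; [apply Cmod_ge_0|]. generalize (Q z Hz); nra.
  - unfold weier, weier'.
    replace (- w)%C with (- z + - (w - z))%C by ring; rewrite cexp_plus.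
    replace ((1 + w) * (cexp (- z) * cexp (- (w - z))) - 1 - ((1 + z) * cexp (- z) - 1) - (w - z) * (- z * cexp (- z)))%C
      with (cexp (- z) * (- ((w - z) * (w - z)) + (1 + w) * (cexp (- (w - z)) - 1 + (w - z))))%C by ring.
    rewrite Cmod_mult.
    assert (Hh : Cmod (w - z) <= 2 * rho).
    { unfold Cminus; generalize (Cmod_triangle w (- z)); rewrite Cmod_opp; lra. }
    apply Rle_trans with (E * (A * Cmod (w - z) ^ 2)).
    + apply Rmult_le_compat; try apply Cmod_ge_0; [now apply Q | now apply P].
    + rewrite <- Rmult_assoc; apply Rmult_le_compat_r; [apply pow2_ge_0 | nra].
Qed.

(** The index is shifted: factor [n] has its zero at -(n+1). *)
Definition weier_n (n : nat) (z : C) : C := weier (z * RtoC (/ (INR n + 1))).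
Definition weier_n' (n : nat) (z : C) : C :=
  (RtoC (/ (INR n + 1)) * weier' (z * RtoC (/ (INR n + 1))))%C.

(** Each bound gains (n+1)^{-2}: the value through quadratic vanishing, the derivative through a
    linear bound and the chain rule, the remainder through the rescaling of w - z. *)
Lemma weier_n_jet (rho : R) : 0 <= rho -> exists K, 0 <= K /\
  forall n, C_jet rho (weier_n n) (weier_n' n) (K / (INR n + 1) ^ 2).
Proof.
  intros Hr; destruct (weier_bounds rho Hr) as [K [HK H]].
  exists (K * (1 + rho + rho ^ 2)); split; [apply Rmult_le_pos; nra|].
  intros n z w Hz Hw.
  assert (Hn := pos_INR n); set (t := / (INR n + 1)).
  assert (Ht : 0 < t) by (apply Rinv_0_lt_compat; lra).
  assert (Ht1 : t <= 1) by (unfold t; rewrite <- Rinv_1; apply Rinv_le_contravar; lra).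
  assert (Hmt : Cmod (RtoC t) = t) by (rewrite Cmod_R, Rabs_right; lra).
  assert (Hs : forall x, Cmod x <= rho -> Cmod (x * RtoC t) <= rho).
  { intros x Hx; rewrite Cmod_mult, Hmt; generalize (Cmod_ge_0 x); nra. }
  destruct (H _ _ (Hs z Hz) (Hs w Hw)) as [H1 [H2 H3]].
  replace (K * (1 + rho + rho ^ 2) / (INR n + 1) ^ 2) with (K * (1 + rho + rho ^ 2) * t ^ 2)
    by (unfold t; field; lra).
  assert (Pz := Cmod_ge_0 z).
  assert (Kt : 0 <= K * t ^ 2) by (apply Rmult_le_pos; [exact HK | apply pow2_ge_0]).
  assert (Hz2 : Cmod z ^ 2 <= rho ^ 2) by (apply pow_incr; lra).
  assert (Hrho2 := pow2_ge_0 rho).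
  unfold weier_n, weier_n'; fold t; split; [|split].
  - apply Rle_trans with (1 := H1); rewrite Cmod_mult, Hmt.
    replace (K * (Cmod z * t) ^ 2) with (K * t ^ 2 * Cmod z ^ 2) by ring.
    replace (K * (1 + rho + rho ^ 2) * t ^ 2) with (K * t ^ 2 * (1 + rho + rho ^ 2)) by ring.
    apply Rmult_le_compat_l; lra.
  - rewrite Cmod_mult, Hmt.
    apply Rle_trans with (t * (K * Cmod (z * RtoC t))); [apply Rmult_le_compat_l; lra|].
    rewrite Cmod_mult, Hmt.
    replace (t * (K * (Cmod z * t))) with (K * t ^ 2 * Cmod z) by ring.
    replace (K * (1 + rho + rho ^ 2) * t ^ 2) with (K * t ^ 2 * (1 + rho + rho ^ 2)) by ring.
    apply Rmult_le_compat_l; lra.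
  - replace (w * RtoC t - z * RtoC t)%C with ((w - z) * RtoC t)%C in H3 by ring.
    rewrite (Cmod_mult (w - z)), Hmt in H3.
    replace ((w - z) * (RtoC t * weier' (z * RtoC t)))%C with ((w - z) * RtoC t * weier' (z * RtoC t))%C by ring.
    apply Rle_trans with (1 := H3).
    replace (K * (Cmod (w - z) * t) ^ 2) with (K * t ^ 2 * 1 * Cmod (w - z) ^ 2) by ring.
    replace (K * (1 + rho + rho ^ 2) * t ^ 2) with (K * t ^ 2 * (1 + rho + rho ^ 2)) by ring.
    apply Rmult_le_compat_r; [apply pow2_ge_0|]; apply Rmult_le_compat_l; lra.
Qed.

Fixpoint weier_prod (N : nat) (z : C) : C :=
  match N with O => RtoC 1 | S n => (weier_prod n z * (1 + weier_n n z))%C end.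

Fixpoint weier_prod' (N : nat) (z : C) : C :=
  match N with
  | O => RtoC 0
  | S n => (weier_prod' n z * (1 + weier_n n z) + weier_prod n z * weier_n' n z)%C
  end.

(** Each factor enlarges the bound by 1 + K'/(N+1)^2 <= exp(K'/(N+1)^2). The exponent 2 K' (1 -
    1/(N+1)) is shaped to absorb this by telescoping and never exceeds 2 K'. *)
Lemma weier_prod_jet (rho : R) : 0 <= rho -> exists B, forall N, C_jet rho (weier_prod N) (weier_prod' N) B.
Proof.
  intros Hr; destruct (weier_n_jet rho Hr) as [K [HK H]].
  pose (K' := (3 + 2 * rho) * K).
  assert (HK' : 0 <= K') by (apply Rmult_le_pos; lra).
  assert (J : forall N, C_jet rho (weier_prod N) (weier_prod' N) (exp (2 * K' * (1 - / (INR N + 1))))).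
  { induction N as [|N IH].
    - intros z w _ _; simpl INR; rewrite Rplus_0_l, Rinv_1, Rminus_diag, Rmult_0_r, exp_0; simpl.
      rewrite Cmod_1, Cmod_0; split; [lra|split; [lra|]].
      replace (RtoC 1 - RtoC 1 - (w - z) * RtoC 0)%C with (RtoC 0) by ring.
      rewrite Cmod_0, Rmult_1_l; generalize (pow2_ge_0 (Cmod (w - z))); simpl; lra.
    - assert (L := C_jet_mult_1_plus _ _ _ _ _ _ _ Hr IH (H N)).
      assert (Hle : exp (2 * K' * (1 - / (INR N + 1))) * (1 + (3 + 2 * rho) * (K / (INR N + 1) ^ 2))
        <= exp (2 * K' * (1 - / (INR (S N) + 1)))).
      { assert (I := inv_square_le N); rewrite S_INR.
        replace (INR N + 1 + 1) with (INR N + 2) by ring.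
        replace (2 * K' * (1 - / (INR N + 2))) with
          (2 * K' * (1 - / (INR N + 1)) + K' * (2 * (/ (INR N + 1) - / (INR N + 2)))) by ring.
        rewrite exp_plus; apply Rmult_le_compat_l; [apply Rlt_le, exp_pos|].
        apply Rle_trans with (2 := exp_ineq1_le _).
        replace ((3 + 2 * rho) * (K / (INR N + 1) ^ 2)) with (K' * / (INR N + 1) ^ 2) by (unfold K', Rdiv; ring).
        apply Rplus_le_compat_l, Rmult_le_compat_l; assumption. }
      intros z w Hz Hw; destruct (L z w Hz Hw) as [L1 [L2 L3]].
      split; [exact (Rle_trans _ _ _ L1 Hle) | split; [exact (Rle_trans _ _ _ L2 Hle)|]].
      apply Rle_trans with (1 := L3), Rmult_le_compat_r; [apply pow2_ge_0 | exact Hle]. }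
  exists (exp (2 * K')); intros N z w Hz Hw.
  destruct (J N z w Hz Hw) as [J1 [J2 J3]].
  assert (Hle : exp (2 * K' * (1 - / (INR N + 1))) <= exp (2 * K')).
  { apply exp_le_compat; assert (0 < / (INR N + 1)) by (apply Rinv_0_lt_compat; generalize (pos_INR N); lra); nra. }
  split; [|split]; [lra | lra |].
  apply Rle_trans with (1 := J3), Rmult_le_compat_r; [apply pow2_ge_0 | exact Hle].
Qed.

Definition weier_inf (z : C) : C := C_Lim (fun N => weier_prod N z).
Definition weier_inf' (z : C) : C := C_Lim (fun N => weier_prod' N z).

Lemma is_C_lim_weier_prod (z : C) :
  is_C_lim (fun N => weier_prod N z) (weier_inf z) /\ is_C_lim (fun N => weier_prod' N z) (weier_inf' z).
Proof.
  assert (Hr := Cmod_ge_0 z).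
  destruct (weier_prod_jet _ Hr) as [B HB]; destruct (weier_n_jet _ Hr) as [K [HK H]].
  assert (HB0 := C_jet_ge_0 _ _ _ _ Hr (HB O)).
  split.
  - apply C_Lim_correct_inv_square with (B * K); intros n; cbn [weier_prod weier_prod'].
    replace (weier_prod n z * (1 + weier_n n z) - weier_prod n z)%C with (weier_prod n z * weier_n n z)%C by ring.
    rewrite Cmod_mult; unfold Rdiv; rewrite Rmult_assoc.
    apply Rmult_le_compat; try apply Cmod_ge_0.
    + apply (HB n z z (Rle_refl _) (Rle_refl _)).
    + apply (H n z z (Rle_refl _) (Rle_refl _)).
  - apply C_Lim_correct_inv_square with (2 * B * K); intros n; cbn [weier_prod weier_prod'].
    replace (weier_prod' n z * (1 + weier_n n z) + weier_prod n z * weier_n' n z - weier_prod' n z)%C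
      with (weier_prod' n z * weier_n n z + weier_prod n z * weier_n' n z)%C by ring.
    apply Rle_trans with (1 := Cmod_triangle _ _); rewrite !Cmod_mult.
    destruct (HB n z z (Rle_refl _) (Rle_refl _)) as [B1 [B2 _]].
    destruct (H n z z (Rle_refl _) (Rle_refl _)) as [H1 [H2 _]].
    replace (2 * B * K / (INR n + 1) ^ 2) with (B * (K / (INR n + 1) ^ 2) + B * (K / (INR n + 1) ^ 2)) by (unfold Rdiv; ring).
    apply Rplus_le_compat; apply Rmult_le_compat; try apply Cmod_ge_0; assumption.
Qed.

Lemma ex_C_derive_weier_inf (z : C) : ex_C_derive weier_inf z.
Proof.
  assert (Hr : 0 <= Cmod z + 1) by (generalize (Cmod_ge_0 z); lra).
  destruct (weier_prod_jet _ Hr) as [B HB].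
  exists (weier_inf' z); apply C_jet_is_C_derive with (Cmod z + 1) B; [|lra].
  apply C_jet_lim with weier_prod weier_prod'; [exact HB| |]; intros w; apply is_C_lim_weier_prod.
Qed.

Lemma one_plus_weier_n (n : nat) (z : C) :
  (1 + weier_n n z)%C = ((1 + z * RtoC (/ (INR n + 1))) * cexp (- (z * RtoC (/ (INR n + 1)))))%C.
Proof. unfold weier_n, weier; ring. Qed.

Lemma one_plus_div_neq_0 (z : C) (n : nat) : z <> (- RtoC (INR n + 1))%C ->
  (1 + z * RtoC (/ (INR n + 1)))%C <> RtoC 0.
Proof.
  intros Hz E; apply Hz.
  assert (Hn := pos_INR n).
  assert (H0 : RtoC (INR n + 1) <> RtoC 0) by (intros H; apply RtoC_inj in H; lra).
  rewrite RtoC_inv in E by lra.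
  replace z with (RtoC (INR n + 1) * ((1 + z * / RtoC (INR n + 1)) - 1))%C by (field; exact H0).
  rewrite E; ring.
Qed.

Lemma weier_prod_neq_0 (z : C) (N : nat) :
  (forall n, z <> (- RtoC (INR n + 1))%C) -> weier_prod N z <> RtoC 0.
Proof.
  intros Hz; induction N as [|N IH]; simpl.
  - intros H; apply RtoC_inj in H; lra.
  - apply Cmult_neq_0; [exact IH|]; rewrite one_plus_weier_n.
    apply Cmult_neq_0; [now apply one_plus_div_neq_0 | apply cexp_neq_0].
Qed.

(** The modulus of a product of factors 1 + x_k is at least 1 minus the sum of the |x_k|. Beyond
    index m that sum is at most 2K/(m+1), which is below 1/2 once m > 4K, and the first m factors
    are non-zero. *)
Lemma weier_inf_neq_0 (z : C) :
  (forall n, z <> (- RtoC (INR n + 1))%C) -> weier_inf z <> RtoC 0.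
Proof.
  intros Hz; assert (Hr := Cmod_ge_0 z).
  destruct (weier_n_jet _ Hr) as [K [HK H]].
  destruct (INR_unbounded (4 * K)) as [m Hm].
  assert (Pm := pos_INR m).
  set (W := Cmod (weier_prod m z)).
  assert (HW : 0 < W) by (apply Cmod_gt_0; now apply weier_prod_neq_0).
  assert (B : forall k, W * (1 - 2 * K * (/ (INR m + 1) - / (INR (m + k) + 1))) <= Cmod (weier_prod (m + k) z)).
  { induction k as [|k IH].
    - rewrite Nat.add_0_r, Rminus_diag, Rmult_0_r, Rminus_0_r, Rmult_1_r; apply Rle_refl.
    - rewrite Nat.add_succ_r; simpl weier_prod; rewrite Cmod_mult.
      destruct (H (m + k)%nat z z (Rle_refl _) (Rle_refl _)) as [H1 _].
      assert (I := inv_square_le (m + k)).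
      set (x := Cmod (weier_n (m + k) z)) in *.
      assert (T : 1 - x <= Cmod (1 + weier_n (m + k) z)).
      { generalize (Cmod_triangle (1 + weier_n (m + k) z) (- weier_n (m + k) z)).
        replace (1 + weier_n (m + k) z + - weier_n (m + k) z)%C with (RtoC 1) by ring.
        rewrite Cmod_1, Cmod_opp; fold x; lra. }
      rewrite S_INR; replace (INR (m + k) + 1 + 1) with (INR (m + k) + 2) by ring.
      assert (Pk := pos_INR (m + k)).
      set (a := / (INR m + 1)) in *; set (b := / (INR (m + k) + 1)) in *; set (c := / (INR (m + k) + 2)) in *.
      assert (Ha : 4 * K * a <= 1).
      { apply Rmult_le_reg_r with (INR m + 1); [lra|]; unfold a; rewrite Rmult_assoc, Rinv_l; lra. }
      assert (Hb : 0 < b) by (apply Rinv_0_lt_compat; lra).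
      assert (Hc : 0 < c) by (apply Rinv_0_lt_compat; lra).
      assert (Hab : b <= a).
      { apply Rinv_le_contravar; [lra|]; rewrite plus_INR; generalize (pos_INR k); lra. }
      unfold Rdiv in H1.
      assert (Hx : x <= 2 * K * (b - c)).
      { apply Rle_trans with (1 := H1); apply (Rmult_le_compat_l K) in I; [lra | exact HK]. }
      assert (Hx0 : 0 <= x) by apply Cmod_ge_0.
      assert (Ka : 0 <= K * b) by (apply Rmult_le_pos; lra).
      assert (Kc : 0 <= K * c) by (apply Rmult_le_pos; lra).
      assert (Kab : K * b <= K * a) by (apply Rmult_le_compat_l; lra).
      assert (Hx1 : x <= 1) by lra.
      set (y := 1 - 2 * K * (a - b)) in *.
      assert (Hy : 0 <= y <= 1) by (unfold y; lra).
      apply Rle_trans with (W * y * (1 - x)).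
      + rewrite (Rmult_assoc W); apply Rmult_le_compat_l; [lra|].
        apply Rle_trans with (y - 2 * K * (b - c)); [unfold y; right; ring|]; nra.
      + apply Rmult_le_compat; try assumption; [apply Rmult_le_pos; lra | lra]. }
  assert (L := is_lim_seq_Cmod _ _ (proj1 (is_C_lim_weier_prod z))).
  apply (is_lim_seq_incr_n _ m) in L.
  assert (HL : W / 2 <= Cmod (weier_inf z)).
  { refine (is_lim_seq_le _ _ (W / 2) (Cmod (weier_inf z)) _ (is_lim_seq_const _) L).
    intros k; rewrite Nat.add_comm; apply Rle_trans with (2 := B k).
    assert (Pk := pos_INR (m + k)).
    assert (Ha : 4 * K * / (INR m + 1) <= 1).
    { apply Rmult_le_reg_r with (INR m + 1); [lra|]; rewrite Rmult_assoc, Rinv_l; lra. }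
    assert (0 <= K * / (INR (m + k) + 1)) by (apply Rmult_le_pos; [lra | apply Rlt_le, Rinv_0_lt_compat; lra]).
    unfold Rdiv; apply Rmult_le_compat_l; lra. }
  apply Cmod_gt_0; lra.
Qed.

(** * The reciprocal Gamma function *)

Definition log_step (n : nat) : R := ln ((INR n + 2) / (INR n + 1)).

(** The logarithms telescope: this is H_N - ln(N+1), with H_N the harmonic number. *)
Fixpoint euler_seq (N : nat) : R :=
  match N with O => 0 | S n => euler_seq n + (/ (INR n + 1) - log_step n) end.

(** With h = 1/(n+1), the inequalities h/(1+h) <= ln(1+h) <= h put the difference between 0 and
    h^2. *)
Lemma log_step_bounds (n : nat) : Rabs (/ (INR n + 1) - log_step n) <= 1 / (INR n + 1) ^ 2.
Proof.
  assert (Hn := pos_INR n); unfold log_step.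
  set (h := / (INR n + 1)).
  assert (Hh : 0 < h) by (apply Rinv_0_lt_compat; lra).
  replace ((INR n + 2) / (INR n + 1)) with (1 + h) by (unfold h; field; lra).
  assert (H1 := exp_ineq1_le (ln (1 + h))); rewrite exp_ln in H1 by lra.
  assert (H2 := exp_ineq1_le (ln (/ (1 + h)))).
  rewrite exp_ln in H2 by (apply Rinv_0_lt_compat; lra).
  rewrite ln_Rinv in H2 by lra.
  assert (E : / (1 + h) = 1 - h / (1 + h)) by (field; lra).
  assert (H3 : h - h / (1 + h) <= h ^ 2).
  { replace (h - h / (1 + h)) with (h ^ 2 * / (1 + h)) by (field; lra).
    rewrite <- (Rmult_1_r (h ^ 2)) at 2; apply Rmult_le_compat_l; [apply pow2_ge_0|].
    rewrite <- Rinv_1; apply Rinv_le_contravar; lra. }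
  replace (1 / (INR n + 1) ^ 2) with (h ^ 2) by (unfold h; field; lra).
  rewrite Rabs_right; lra.
Qed.

Definition euler_gamma : R := real (Lim_seq euler_seq).

Lemma is_lim_seq_euler_gamma : is_lim_seq euler_seq euler_gamma.
Proof.
  apply Lim_seq_correct', ex_finite_lim_seq_inv_square with 1; intros n; simpl.
  replace (euler_seq n + (/ (INR n + 1) - log_step n) - euler_seq n) with (/ (INR n + 1) - log_step n) by ring.
  exact (log_step_bounds n).
Qed.

Definition RGamma (z : C) : C := (z * (cexp (RtoC euler_gamma * z) * weier_inf z))%C.

(* Equal to z (z+1) ... (z+N) / (N! (N+1)^z), the reciprocal of Gauss's product. *)
Definition gauss_seq (N : nat) (z : C) : C :=
  (z * (cexp (RtoC (euler_seq N) * z) * weier_prod N z))%C.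

Lemma ex_C_derive_scal (c : C) (z : C) : ex_C_derive (fun w => c * w)%C z.
Proof. apply ex_C_derive_mult; [apply ex_C_derive_const | apply ex_C_derive_id]. Qed.

Lemma ex_C_derive_RGamma (z : C) : ex_C_derive RGamma z.
Proof.
  apply ex_C_derive_mult; [apply ex_C_derive_id|].
  apply ex_C_derive_mult; [|apply ex_C_derive_weier_inf].
  apply (ex_C_derive_comp cexp); [apply ex_C_derive_cexp | apply ex_C_derive_scal].
Qed.

Lemma is_C_lim_continuous (f : C -> C) (u : nat -> C) (l : C) :
  ex_C_derive f l -> is_C_lim u l -> is_C_lim (fun n => f (u n)) (f l).
Proof.
  intros [d Hd] Hu.
  destruct (Hd 1 Rlt_0_1) as [r [Hr H]].
  apply is_lim_seq_spec; intros e.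
  assert (HK : 0 < 1 + Cmod d) by (generalize (Cmod_ge_0 d); lra).
  assert (Hd' : 0 < Rmin r (e / (1 + Cmod d))).
  { apply Rmin_glb_lt; [exact Hr | apply Rdiv_lt_0_compat; [apply cond_pos | exact HK]]. }
  apply is_lim_seq_spec in Hu; destruct (Hu (mkposreal _ Hd')) as [N HN].
  exists N; intros n Hn; assert (Hw := HN n Hn); simpl in Hw.
  rewrite Rminus_0_r, Rabs_right in Hw by (apply Rle_ge, Cmod_ge_0).
  rewrite Rminus_0_r, Rabs_right by (apply Rle_ge, Cmod_ge_0).
  assert (H1 := H (u n) (Rlt_le_trans _ _ _ Hw (Rmin_l _ _))).
  assert (H2 := Rlt_le_trans _ _ _ Hw (Rmin_r _ _)).
  assert (T := Cmod_triangle (f (u n) - f l - (u n - l) * d) ((u n - l) * d)).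
  replace (f (u n) - f l - (u n - l) * d + (u n - l) * d)%C with (f (u n) - f l)%C in T by ring.
  rewrite Cmod_mult in T.
  apply (Rmult_lt_compat_r (1 + Cmod d)) in H2; [|exact HK].
  unfold Rdiv in H2; rewrite Rmult_assoc, Rinv_l in H2 by lra; lra.
Qed.

Lemma is_C_lim_gauss_seq (z : C) : is_C_lim (fun N => gauss_seq N z) (RGamma z).
Proof.
  apply is_C_lim_mult; [apply is_C_lim_const|].
  apply is_C_lim_mult; [|apply is_C_lim_weier_prod].
  apply (is_C_lim_continuous cexp); [apply ex_C_derive_cexp|].
  apply is_C_lim_mult; [apply is_C_lim_RtoC, is_lim_seq_euler_gamma | apply is_C_lim_const].
Qed.

(** The correction e^{-z/(N+1)} of the Weierstrass factor cancels the term 1/(N+1) of [euler_seq],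
    leaving the step (1 + z/(N+1)) ((N+1)/(N+2))^z of Gauss's product. *)
Lemma gauss_seq_S (N : nat) (z : C) :
  gauss_seq (S N) z =
  (gauss_seq N z * ((1 + z * RtoC (/ (INR N + 1))) * cexp (- (RtoC (log_step N) * z))))%C.
Proof.
  unfold gauss_seq; cbn [weier_prod euler_seq]; rewrite one_plus_weier_n.
  rewrite RtoC_plus, RtoC_minus.
  replace ((RtoC (euler_seq N) + (RtoC (/ (INR N + 1)) - RtoC (log_step N))) * z)%C
    with (RtoC (euler_seq N) * z + (z * RtoC (/ (INR N + 1)) + - (RtoC (log_step N) * z)))%C by ring.
  rewrite !cexp_plus.
  assert (E : (cexp (z * RtoC (/ (INR N + 1))) * cexp (- (z * RtoC (/ (INR N + 1)))))%C = RtoC 1).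
  { rewrite <- cexp_plus, <- cexp_0; f_equal; ring. }
  replace (z * (cexp (RtoC (euler_seq N) * z) * (cexp (z * RtoC (/ (INR N + 1))) * cexp (- (RtoC (log_step N) * z))) *
    (weier_prod N z * ((1 + z * RtoC (/ (INR N + 1))) * cexp (- (z * RtoC (/ (INR N + 1))))))))%C
  with ((cexp (z * RtoC (/ (INR N + 1))) * cexp (- (z * RtoC (/ (INR N + 1)))))
    * (z * (cexp (RtoC (euler_seq N) * z) * weier_prod N z) * ((1 + z * RtoC (/ (INR N + 1))) * cexp (- (RtoC (log_step N) * z)))))%C by ring.
  rewrite E; ring.
Qed.

Lemma exp_opp_log_step (n : nat) : exp (- log_step n) = (INR n + 1) / (INR n + 2).
Proof.
  assert (Hn := pos_INR n); unfold log_step.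
  rewrite exp_Ropp, exp_ln by (apply Rdiv_lt_0_compat; lra); field; lra.
Qed.

(** At a finite stage the functional equation fails only by the factor 1 + z/(N+1), which tends to
    1. *)
Lemma gauss_seq_shift (N : nat) (z : C) :
  (z * gauss_seq N (z + 1))%C = (gauss_seq N z * (1 + z * RtoC (/ (INR N + 1))))%C.
Proof.
  induction N as [|N IH].
  - unfold gauss_seq; simpl; rewrite Rplus_0_l, Rinv_1.
    rewrite !Cmult_0_l, cexp_0; ring.
  - rewrite !gauss_seq_S.
    replace (z * (gauss_seq N (z + 1) * ((1 + (z + 1) * RtoC (/ (INR N + 1))) * cexp (- (RtoC (log_step N) * (z + 1))))))%C
      with ((z * gauss_seq N (z + 1)) * ((1 + (z + 1) * RtoC (/ (INR N + 1))) * cexp (- (RtoC (log_step N) * (z + 1)))))%C by ring.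
    rewrite IH.
    replace (- (RtoC (log_step N) * (z + 1)))%C with (- (RtoC (log_step N) * z) + RtoC (- log_step N))%C
      by (rewrite RtoC_opp; ring).
    rewrite cexp_plus, cexp_RtoC, exp_opp_log_step, S_INR.
    assert (E : ((1 + (z + 1) * RtoC (/ (INR N + 1))) * RtoC ((INR N + 1) / (INR N + 2)))%C
       = (1 + z * RtoC (/ (INR N + 1 + 1)))%C).
    { assert (Hn := pos_INR N).
      replace (INR N + 1 + 1) with (INR N + 2) by ring.
      replace (RtoC ((INR N + 1) / (INR N + 2))) with (RtoC (1 - / (INR N + 2))) by (f_equal; field; lra).
      replace ((1 + (z + 1) * RtoC (/ (INR N + 1))) * RtoC (1 - / (INR N + 2)))%C
        with (RtoC ((1 + / (INR N + 1)) * (1 - / (INR N + 2))) + z * RtoC (/ (INR N + 1) * (1 - / (INR N + 2))))%C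
        by (rewrite !RtoC_mult, RtoC_plus; ring).
      f_equal; [f_equal; field; lra | f_equal; f_equal; field; lra]. }
    rewrite <- E; ring.
Qed.

Lemma is_lim_seq_inv_INR_1 : is_lim_seq (fun n => / (INR n + 1)) 0.
Proof.
  apply (is_lim_seq_inv (fun n => INR n + 1) p_infty); [|discriminate].
  apply is_lim_seq_ext with (fun n => INR (S n)); [intros n; apply S_INR|].
  apply (is_lim_seq_incr_1 INR p_infty), is_lim_seq_INR.
Qed.

Lemma RGamma_rec (z : C) : RGamma z = (z * RGamma (z + 1))%C.
Proof.
  apply is_C_lim_eq with (fun N => gauss_seq N z * (1 + z * RtoC (/ (INR N + 1))))%C.
  - replace (RGamma z) with (RGamma z * (1 + z * RtoC 0))%C by ring.
    apply is_C_lim_mult; [apply is_C_lim_gauss_seq|].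
    apply is_C_lim_plus; [apply is_C_lim_const|].
    apply is_C_lim_mult; [apply is_C_lim_const | apply is_C_lim_RtoC, is_lim_seq_inv_INR_1].
  - apply is_C_lim_ext with (fun N => z * gauss_seq N (z + 1))%C; [intros N; apply gauss_seq_shift|].
    apply is_C_lim_mult; [apply is_C_lim_const | apply is_C_lim_gauss_seq].
Qed.

Lemma Gamma_INR_pos (N : nat) : 0 < Gamma (INR N + 1).
Proof.
  induction N as [|N IH]; [simpl; rewrite Rplus_0_l, Gamma_1; lra|].
  rewrite S_INR, Gamma_succ by (generalize (pos_INR N); lra).
  apply Rmult_lt_0_compat; [generalize (pos_INR N); lra | exact IH].
Qed.

(** Gamma(x) absorbs the product x (x+1) ... (x+N) into Gamma(N+1+x), and N! is Gamma(N+1). What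
    remains is the ratio controlled by log-convexity. *)
Lemma Gamma_gauss_seq (x : R) (N : nat) : 0 < x ->
  (RtoC (Gamma x) * gauss_seq N (RtoC x))%C =
  RtoC (Gamma (INR N + 1 + x) / (Gamma (INR N + 1) * Rpower (INR N + 1) x)).
Proof.
  intros Hx; induction N as [|N IH].
  - unfold gauss_seq; simpl; rewrite !Rplus_0_l, Cmult_0_l, cexp_0, Gamma_1, Rpower_1_l.
    rewrite (Rplus_comm 1), Gamma_succ, RtoC_div, !RtoC_mult by lra.
    field; intros H; apply RtoC_inj in H; lra.
  - rewrite gauss_seq_S, Cmult_assoc, IH, S_INR.
    assert (Hn := pos_INR N).
    replace (- (RtoC (log_step N) * RtoC x))%C with (RtoC (- log_step N * x)) by (rewrite RtoC_mult, RtoC_opp; ring).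
    rewrite cexp_RtoC, <- !RtoC_mult, <- RtoC_plus, <- !RtoC_mult; f_equal.
    replace (INR N + 1 + 1 + x) with ((INR N + 1 + x) + 1) by ring.
    rewrite (Gamma_succ (INR N + 1 + x)), (Gamma_succ (INR N + 1)) by lra.
    replace (INR N + 1 + 1) with (INR N + 2) by ring.
    assert (E : Rpower (INR N + 2) x * exp (- log_step N * x) = Rpower (INR N + 1) x).
    { unfold Rpower, log_step; rewrite <- exp_plus, ln_div by lra; f_equal; ring. }
    rewrite <- E; clear E.
    assert (G := Gamma_INR_pos N).
    assert (P1 := Rpower_pos (INR N + 2) x); assert (P2 := exp_pos (- log_step N * x)).
    field; repeat split; lra.
Qed.

(** With s = N+1, the convexity inequality from s to s+x bounds the ratio above by 1; from s+x to
    s+1 it bounds it below by s/(s+x). The gap x/(s+x) is at most 1/s. *)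
Lemma Gamma_ratio_bounds (x : R) (N : nat) : 0 < x <= 1 ->
  Rabs (Gamma (INR N + 1 + x) / (Gamma (INR N + 1) * Rpower (INR N + 1) x) - 1) <= / (INR N + 1).
Proof.
  intros Hx; assert (HN := pos_INR N); set (s := INR N + 1).
  assert (Hs : 0 < s) by (unfold s; lra).
  assert (HG : 0 < Gamma s) by apply Gamma_INR_pos.
  assert (P := Rpower_pos s x).
  assert (H1 : Gamma (s + x) <= Rpower s x * Gamma s) by (apply Gamma_add_le; lra).
  assert (H2 : Gamma (s + 1) <= Rpower (s + x) (1 - x) * Gamma (s + x)).
  { replace (s + 1) with ((s + x) + (1 - x)) by ring; apply Gamma_add_le; lra. }
  rewrite Gamma_succ in H2 by exact Hs.
  assert (H3 : Rpower (s + x) (1 - x) * Rpower s x <= s + x).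
  { apply Rle_trans with (Rpower (s + x) (1 - x) * Rpower (s + x) x).
    - apply Rmult_le_compat_l; [apply Rlt_le, Rpower_pos|].
      apply Rle_Rpower_l; lra.
    - rewrite <- Rpower_plus; replace (1 - x + x) with 1 by ring; rewrite Rpower_1; lra. }
  set (D := Gamma s * Rpower s x).
  assert (HD : 0 < D) by now apply Rmult_lt_0_compat.
  assert (U : Gamma (s + x) / D <= 1).
  { apply Rmult_le_reg_r with D; [exact HD|]; unfold Rdiv; rewrite Rmult_assoc, Rinv_l by lra; unfold D; lra. }
  assert (L : s <= (s + x) * (Gamma (s + x) / D)).
  { apply Rmult_le_reg_r with D; [exact HD|].
    replace ((s + x) * (Gamma (s + x) / D) * D) with ((s + x) * Gamma (s + x)) by (field; lra).
    apply Rle_trans with (Rpower (s + x) (1 - x) * Gamma (s + x) * Rpower s x).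
    - unfold D; rewrite <- Rmult_assoc; apply Rmult_le_compat_r; lra.
    - replace (Rpower (s + x) (1 - x) * Gamma (s + x) * Rpower s x)
        with (Rpower (s + x) (1 - x) * Rpower s x * Gamma (s + x)) by ring.
      apply Rmult_le_compat_r; [|exact H3].
      (* [Gamma (s + x)] is non-negative because a positive multiple of it is at least s Gamma(s) >
         0. *)
      assert (HR := Rpower_pos (s + x) (1 - x)).
      assert (0 < s * Gamma s) by now apply Rmult_lt_0_compat.
      apply Rnot_lt_le; intros Hneg; nra. }
  rewrite Rabs_left1 by lra.
  apply Rmult_le_reg_r with s; [exact Hs|]; rewrite Rinv_l by lra; nra.
Qed.

(** Induction on an integer above x: the two recurrences compensate each other and bring x down to
    (0, 1], where the limit of Gauss's product decides. *)
Lemma Gamma_RGamma (x : R) : 0 < x -> (RtoC (Gamma x) * RGamma (RtoC x))%C = RtoC 1.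
Proof.
  destruct (INR_unbounded x) as [n Hn]; revert x Hn.
  induction n as [|n IH]; intros x Hn Hx; [simpl in Hn; lra|].
  destruct (Rle_lt_dec x 1) as [H1|H1].
  - apply is_C_lim_eq with (fun N => RtoC (Gamma x) * gauss_seq N (RtoC x))%C.
    + apply is_C_lim_mult; [apply is_C_lim_const | apply is_C_lim_gauss_seq].
    + apply is_C_lim_ext with (1 := fun N => eq_sym (Gamma_gauss_seq x N Hx)).
      apply is_C_lim_RtoC.
      apply is_lim_seq_ext with (fun N => (Gamma (INR N + 1 + x) / (Gamma (INR N + 1) * Rpower (INR N + 1) x) - 1) + 1);
        [intros N; ring|].
      replace (Finite 1) with (Finite (0 + 1)) by (f_equal; ring).
      apply is_lim_seq_plus'; [|apply is_lim_seq_const].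
      apply (proj2 (is_lim_seq_abs_0 _)).
      refine (is_lim_seq_squeeze_0 _ _ _ is_lim_seq_inv_INR_1); intros N.
      split; [apply Rabs_pos | apply Gamma_ratio_bounds; lra].
  - rewrite S_INR in Hn.
    rewrite <- (IH (x - 1)) by lra.
    rewrite (RGamma_rec (RtoC (x - 1))).
    replace x with ((x - 1) + 1) at 1 by ring; rewrite Gamma_succ, RtoC_mult by lra.
    replace (RtoC (x - 1) + 1)%C with (RtoC x) by (rewrite RtoC_minus; ring); ring.
Qed.

Lemma RGamma_RtoC (x : R) : 0 < x -> (/ RGamma (RtoC x))%C = RtoC (Gamma x).
Proof.
  intros Hx; assert (E := Gamma_RGamma x Hx).
  assert (H0 : RGamma (RtoC x) <> RtoC 0).
  { intros H; rewrite H, Cmult_0_r in E; apply RtoC_inj in E; lra. }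
  replace (RtoC (Gamma x)) with (RtoC (Gamma x) * RGamma (RtoC x) * / RGamma (RtoC x))%C by (field; exact H0).
  rewrite E; ring.
Qed.

(** * Zeros of the reciprocal Gamma function and their order *)

Lemma RGamma_neq_0 (z : C) : (forall j : nat, z <> (- RtoC (INR j))%C) -> RGamma z <> RtoC 0.
Proof.
  intros Hz; apply Cmult_neq_0; [|apply Cmult_neq_0; [apply cexp_neq_0|]].
  - intros H; apply (Hz O); rewrite H; simpl; ring.
  - apply weier_inf_neq_0; intros n; rewrite <- S_INR; apply Hz.
Qed.

(** The quotient of [RGamma z] by z + j, written without division as z (z+1) ... (z+j-1) times
    [RGamma] at z+j+1. It is therefore entire, including at z = -j. *)
Fixpoint RGamma_cofactor (j : nat) (z : C) : C :=
  match j with O => RGamma (z + 1) | S i => (z * RGamma_cofactor i (z + 1))%C end.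

Lemma RGamma_cofactor_spec (j : nat) (z : C) :
  RGamma z = ((z + RtoC (INR j)) * RGamma_cofactor j z)%C.
Proof.
  revert z; induction j as [|j IH]; intros z; cbn [RGamma_cofactor].
  - simpl; rewrite RGamma_rec; ring.
  - rewrite RGamma_rec, (IH (z + 1)%C), S_INR, RtoC_plus; ring.
Qed.

Lemma ex_C_derive_RGamma_cofactor (j : nat) (z : C) : ex_C_derive (RGamma_cofactor j) z.
Proof.
  assert (S1 : forall w, ex_C_derive (fun w => w + 1)%C w).
  { intros w; apply ex_C_derive_plus; [apply ex_C_derive_id | apply ex_C_derive_const]. }
  revert z; induction j as [|j IH]; intros z; cbn [RGamma_cofactor].
  - apply (ex_C_derive_comp RGamma); [apply ex_C_derive_RGamma | apply S1].
  - apply ex_C_derive_mult; [apply ex_C_derive_id|].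
    apply (ex_C_derive_comp (RGamma_cofactor j)); [apply IH | apply S1].
Qed.

(** This makes the zero of [RGamma] at -j simple. The value is (-j)(-j+1) ... (-1) times [RGamma] at
    1. *)
Lemma RGamma_cofactor_neq_0 (j : nat) : RGamma_cofactor j (- RtoC (INR j))%C <> RtoC 0.
Proof.
  induction j as [|j IH]; cbn [RGamma_cofactor].
  - replace (- RtoC (INR 0) + 1)%C with (RtoC 1) by (simpl; ring).
    intros H; generalize (Gamma_RGamma 1 Rlt_0_1); rewrite H, Cmult_0_r.
    intros E; apply RtoC_inj in E; lra.
  - assert (Hj := pos_INR j).
    apply Cmult_neq_0.
    + rewrite S_INR, <- RtoC_opp; intros H; apply RtoC_inj in H; lra.
    + replace (- RtoC (INR (S j)) + 1)%C with (- RtoC (INR j))%C; [exact IH|].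
      rewrite S_INR, RtoC_plus; ring.
Qed.

(** * The meromorphic continuation *)

(** [/ RGamma] stands for the complex Gamma function, since [Gamma] is defined on the reals. At a
    zero of [RGamma] the inverse takes a default value, which the definition of a pole ignores. *)
Definition gen_fresnel (s : R) (p q : C) : C :=
  (/ p * (cexp (RtoC s * Ci * RtoC (PI / 2) * (q * / p)) * / RGamma (q * / p)))%C.

Lemma gen_fresnel_RtoC (s p q : R) : 0 < p -> 0 < q ->
  gen_fresnel s (RtoC p) (RtoC q) =
  (RtoC (/ p) * cexp (RtoC s * Ci * RtoC (PI / 2 * (q / p))) * RtoC (Gamma (q / p)))%C.
Proof.
  intros Hp Hq; unfold gen_fresnel.
  assert (E : (RtoC q * / RtoC p)%C = RtoC (q / p)) by (rewrite RtoC_div by lra; reflexivity).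
  rewrite E, RGamma_RtoC by now apply Rdiv_lt_0_compat.
  rewrite RtoC_inv by lra.
  replace (RtoC s * Ci * RtoC (PI / 2) * RtoC (q / p))%C
    with (RtoC s * Ci * RtoC (PI / 2 * (q / p)))%C by (rewrite RtoC_mult; ring).
  ring.
Qed.

Lemma ex_C_derive_exp_factor (s : R) (u : C -> C) (z : C) : ex_C_derive u z ->
  ex_C_derive (fun w => cexp (RtoC s * Ci * RtoC (PI / 2) * u w))%C z.
Proof.
  intros Hu; apply (ex_C_derive_comp cexp (fun w => RtoC s * Ci * RtoC (PI / 2) * u w)%C).
  - apply ex_C_derive_cexp.
  - apply ex_C_derive_mult; [apply ex_C_derive_const | exact Hu].
Qed.

Lemma Cinv_neq_0 (z : C) : z <> RtoC 0 -> (/ z)%C <> RtoC 0.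
Proof.
  intros Hz E; assert (H := Cinv_r z Hz); rewrite E, Cmult_0_r in H.
  apply RtoC_inj in H; lra.
Qed.

Lemma ex_C_derive_inv_comp (h : C -> C) (z : C) :
  ex_C_derive h z -> h z <> RtoC 0 -> ex_C_derive (fun w => / h w)%C z.
Proof. intros Hh H0; apply (ex_C_derive_comp Cinv h); [now apply ex_C_derive_inv | exact Hh]. Qed.

Lemma ex_C_derive_mult_r (c z : C) : ex_C_derive (fun w => w * c)%C z.
Proof. apply ex_C_derive_mult; [apply ex_C_derive_id | apply ex_C_derive_const]. Qed.

Lemma ex_C_derive_mult_inv (c z : C) : z <> RtoC 0 -> ex_C_derive (fun w => c * / w)%C z.
Proof.
  intros Hz; apply ex_C_derive_mult; [apply ex_C_derive_const|].
  now apply (ex_C_derive_inv_comp (fun w => w)); [apply ex_C_derive_id|].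
Qed.

Lemma neq_near (z a : C) : z <> a -> exists r, 0 < r /\ forall w, Cmod (w - z) < r -> w <> a.
Proof.
  intros Hz.
  destruct (ex_C_derive_nonzero_near (fun w => w + - a)%C z) as [r [Hr H]].
  - apply ex_C_derive_plus; [apply ex_C_derive_id | apply ex_C_derive_const].
  - intros E; apply Hz; replace z with (z + - a + a)%C by ring; rewrite E; ring.
  - exists r; split; [exact Hr|]; intros w Hw E; apply (H w Hw); rewrite E; ring.
Qed.

(** At a = -p j one has q/p + j = (q - a)/p, so the prefactor 1/p cancels and the regular part is
    the exponential divided by the cofactor. *)
Lemma gen_fresnel_q_pole (s : R) (p : C) (j : nat) : p <> RtoC 0 ->
  pole_of_order 1 (fun q => gen_fresnel s p q) (- (p * RtoC (INR j)))%C.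
Proof.
  intros Hp; set (a := (- (p * RtoC (INR j)))%C).
  assert (Ea : (a * / p)%C = (- RtoC (INR j))%C) by (unfold a; field; exact Hp).
  assert (DT : forall w, ex_C_derive (fun q => RGamma_cofactor j (q * / p)) w).
  { intros w; apply (ex_C_derive_comp (RGamma_cofactor j)); [apply ex_C_derive_RGamma_cofactor | apply ex_C_derive_mult_r]. }
  assert (T0 : RGamma_cofactor j (a * / p) <> RtoC 0) by (rewrite Ea; apply RGamma_cofactor_neq_0).
  destruct (ex_C_derive_nonzero_near _ a (DT a) T0) as [r [Hr Hnz]].
  apply pole_of_order_1_intro with
    (fun q => cexp (RtoC s * Ci * RtoC (PI / 2) * (q * / p)) * / RGamma_cofactor j (q * / p))%C r; [exact Hr| | |].
  - intros w Hw; apply ex_C_derive_mult.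
    + apply ex_C_derive_exp_factor, ex_C_derive_mult_r.
    + apply (ex_C_derive_inv_comp (fun q => RGamma_cofactor j (q * / p))); [apply DT | now apply Hnz].
  - apply Cmult_neq_0; [apply cexp_neq_0 | apply Cinv_neq_0, T0].
  - intros w Hw Hwa; unfold gen_fresnel.
    rewrite (RGamma_cofactor_spec j).
    replace (w * / p + RtoC (INR j))%C with ((w - a) * / p)%C by (unfold a; field; exact Hp).
    assert (Hwa' : (w - a)%C <> RtoC 0).
    { intros E; apply Hwa; replace w with ((w - a) + a)%C by ring; rewrite E; ring. }
    assert (HT := Hnz w Hw); cbv beta in HT.
    set (T := RGamma_cofactor j (w * / p)) in *; set (X := cexp _).
    field; auto.
Qed.

(** Away from the zeros of [RGamma] all factors are holomorphic, and none vanishes: the exponential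
    has no zeros and the others are reciprocals. *)
Lemma gen_fresnel_q_regular (s : R) (p q : C) : p <> RtoC 0 ->
  ~ (exists j : nat, q = (- (p * RtoC (INR j)))%C) ->
  holomorphic_at (fun q => gen_fresnel s p q) q /\ gen_fresnel s p q <> RtoC 0.
Proof.
  intros Hp Hq.
  assert (R0 : RGamma (q * / p) <> RtoC 0).
  { apply RGamma_neq_0; intros j E; apply Hq; exists j.
    replace q with (p * (q * / p))%C by (field; exact Hp); rewrite E; ring. }
  assert (DR : forall w, ex_C_derive (fun q => RGamma (q * / p)) w).
  { intros w; apply (ex_C_derive_comp RGamma); [apply ex_C_derive_RGamma | apply ex_C_derive_mult_r]. }
  split.
  - destruct (ex_C_derive_nonzero_near _ q (DR q) R0) as [r [Hr Hnz]].
    apply holomorphic_at_of_ex_C_derive with r; [exact Hr|]; intros w Hw; unfold gen_fresnel.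
    apply ex_C_derive_mult; [apply ex_C_derive_const|]; apply ex_C_derive_mult.
    + apply ex_C_derive_exp_factor, ex_C_derive_mult_r.
    + apply (ex_C_derive_inv_comp (fun q => RGamma (q * / p))); [apply DR | now apply Hnz].
  - unfold gen_fresnel; repeat apply Cmult_neq_0;
      [now apply Cinv_neq_0 | apply cexp_neq_0 | now apply Cinv_neq_0].
Qed.

(** At a = -q/j one has q/p + j = j (p - a)/p. The p cancels the prefactor 1/p, and 1/j stays in the
    regular part. *)
Lemma gen_fresnel_p_pole (s : R) (q : C) (j : nat) : (1 <= j)%nat ->
  (- (q / RtoC (INR j)))%C <> RtoC 0 ->
  pole_of_order 1 (fun p => gen_fresnel s p q) (- (q / RtoC (INR j)))%C.
Proof.
  intros Hj Ha0; set (a := (- (q / RtoC (INR j)))%C) in *.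
  assert (J0 : RtoC (INR j) <> RtoC 0) by (intros E; apply RtoC_inj in E; apply le_INR in Hj; simpl in Hj; lra).
  assert (Eq : q = (- (a * RtoC (INR j)))%C) by (unfold a; field; exact J0).
  assert (Ea : (q * / a)%C = (- RtoC (INR j))%C) by (rewrite Eq; field; exact Ha0).
  assert (DT : forall w, w <> RtoC 0 -> ex_C_derive (fun p => RGamma_cofactor j (q * / p)) w).
  { intros w Hw; apply (ex_C_derive_comp (RGamma_cofactor j)); [apply ex_C_derive_RGamma_cofactor | now apply ex_C_derive_mult_inv]. }
  assert (T0 : RGamma_cofactor j (q * / a) <> RtoC 0) by (rewrite Ea; apply RGamma_cofactor_neq_0).
  destruct (ex_C_derive_nonzero_near _ a (DT a Ha0) T0) as [r1 [Hr1 Hnz1]].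
  destruct (neq_near a (RtoC 0) Ha0) as [r2 [Hr2 Hnz2]].
  assert (Hmin : forall w, Cmod (w - a) < Rmin r1 r2 -> Cmod (w - a) < r1 /\ Cmod (w - a) < r2).
  { intros w Hw; split; [apply Rlt_le_trans with (2 := Rmin_l r1 r2) | apply Rlt_le_trans with (2 := Rmin_r r1 r2)]; exact Hw. }
  apply pole_of_order_1_intro with
    (fun p => cexp (RtoC s * Ci * RtoC (PI / 2) * (q * / p)) * (/ RtoC (INR j) * / RGamma_cofactor j (q * / p)))%C (Rmin r1 r2).
  - now apply Rmin_glb_lt.
  - intros w Hw; destruct (Hmin w Hw) as [Hw1 Hw2]; apply ex_C_derive_mult.
    + apply ex_C_derive_exp_factor, ex_C_derive_mult_inv; now apply Hnz2.
    + apply ex_C_derive_mult; [apply ex_C_derive_const|].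
      apply (ex_C_derive_inv_comp (fun p => RGamma_cofactor j (q * / p))); [apply DT; now apply Hnz2 | now apply Hnz1].
  - repeat apply Cmult_neq_0; [apply cexp_neq_0 | now apply Cinv_neq_0 | now apply Cinv_neq_0].
  - intros w Hw Hwa; destruct (Hmin w Hw) as [Hw1 Hw2]; unfold gen_fresnel.
    assert (Hw0 := Hnz2 w Hw2).
    rewrite (RGamma_cofactor_spec j).
    replace (q * / w + RtoC (INR j))%C with ((w - a) * (RtoC (INR j) * / w))%C by (rewrite Eq; field; exact Hw0).
    assert (Hwa' : (w - a)%C <> RtoC 0).
    { intros E; apply Hwa; replace w with ((w - a) + a)%C by ring; rewrite E; ring. }
    assert (HT := Hnz1 w Hw1); cbv beta in HT.
    set (T := RGamma_cofactor j (q * / w)) in *; set (X := cexp _).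
    field; auto.
Qed.

Lemma gen_fresnel_p_regular (s : R) (p q : C) : p <> RtoC 0 ->
  ~ (exists j : nat, (1 <= j)%nat /\ p = (- (q / RtoC (INR j)))%C) ->
  holomorphic_at (fun p => gen_fresnel s p q) p.
Proof.
  intros Hp Hpj.
  destruct (classic (q = RtoC 0)) as [->|Hq].
  - (* every [q / p] is the pole 0 of Gamma, where the junk value of
       [/ RGamma] makes the function a constant multiple of [/ p] *)
    destruct (neq_near p (RtoC 0) Hp) as [r [Hr Hnz]].
    apply holomorphic_at_of_ex_C_derive with r; [exact Hr|]; intros w Hw.
    destruct (ex_C_derive_mult_inv (cexp (RtoC s * Ci * RtoC (PI / 2) * 0) * / RGamma 0)%C w (Hnz w Hw)) as [d Hd].
    exists d; intros e He; destruct (Hd e He) as [r' [Hr' H]]; exists r'; split; [exact Hr'|].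
    intros z Hz; unfold gen_fresnel; rewrite !Cmult_0_l, !(Cmult_comm (/ _) (cexp _ * _)).
    now apply H.
  - assert (R0 : RGamma (q * / p) <> RtoC 0).
    (* If q/p = -j, then j = 0 would force q = 0, and j >= 1 gives an excluded point p = -q/j. *)
    { apply RGamma_neq_0; intros [|j] E.
      - apply Hq; replace q with (p * (q * / p))%C by (field; exact Hp); rewrite E; simpl; ring.
      - apply Hpj; exists (S j); split; [lia|].
        assert (J0 : RtoC (INR (S j)) <> RtoC 0) by (intros E'; apply RtoC_inj in E'; generalize (lt_0_INR (S j) (PeanoNat.Nat.lt_0_succ j)); lra).
        replace q with (p * (q * / p))%C by (field; exact Hp); rewrite E; field; exact J0. }
    assert (DR : forall w, w <> RtoC 0 -> ex_C_derive (fun p => RGamma (q * / p)) w).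
    { intros w Hw; apply (ex_C_derive_comp RGamma); [apply ex_C_derive_RGamma | now apply ex_C_derive_mult_inv]. }
    destruct (ex_C_derive_nonzero_near _ p (DR p Hp) R0) as [r1 [Hr1 Hnz1]].
    destruct (neq_near p (RtoC 0) Hp) as [r2 [Hr2 Hnz2]].
    apply holomorphic_at_of_ex_C_derive with (Rmin r1 r2); [now apply Rmin_glb_lt|]; intros w Hw.
    assert (Hw1 := Rlt_le_trans _ _ _ Hw (Rmin_l r1 r2)); assert (Hw2 := Rlt_le_trans _ _ _ Hw (Rmin_r r1 r2)).
    assert (Hw0 := Hnz2 w Hw2); unfold gen_fresnel.
    apply ex_C_derive_mult; [now apply ex_C_derive_inv|]; apply ex_C_derive_mult.
    + now apply ex_C_derive_exp_factor, ex_C_derive_mult_inv.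
    + apply (ex_C_derive_inv_comp (fun p => RGamma (q * / p))); [now apply DR | now apply Hnz1].
Qed.

Theorem theorem5p2 (s : R) (hs : s = 1 \/ s = -1) :
  (forall p q : R, 0 < p -> 0 < q ->
     is_Os_integral s p q
       (RtoC (/ p) * cexp (RtoC s * Ci * RtoC (PI / 2 * (q / p)))
        * RtoC (Gamma (q / p)))%C) /\
  (exists F : C -> C -> C,
     (forall p q : R, 0 < p -> 0 < q ->
        is_Os_integral s p q (F (RtoC p) (RtoC q))) /\
     (* j = 0 is included: q = 0 is a pole as well *)
     (forall p : C, p <> RtoC 0 ->
        meromorphic_on (fun _ => True) (fun q => F p q) /\
        (forall q : C,
           ((exists j : nat, q = (- (p * RtoC (INR j)))%C) ->
              pole_of_order 1 (fun q' => F p q') q) /\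
           (~ (exists j : nat, q = (- (p * RtoC (INR j)))%C) ->
              holomorphic_at (fun q' => F p q') q /\ F p q <> RtoC 0))) /\
     (forall q : C,
        meromorphic_on (fun p => p <> RtoC 0) (fun p => F p q) /\
        (forall p : C, p <> RtoC 0 ->
           ((exists j : nat, (1 <= j)%nat /\ p = (- (q / RtoC (INR j)))%C) ->
              pole_of_order 1 (fun p' => F p' q) p) /\
           (~ (exists j : nat, (1 <= j)%nat /\ p = (- (q / RtoC (INR j)))%C) ->
              holomorphic_at (fun p' => F p' q) p)))).
Proof.
  split; [intros p q; now apply is_Os_integral_fresnel|].
  exists (gen_fresnel s); split; [|split].
  - intros p q Hp Hq; rewrite gen_fresnel_RtoC by assumption.
    now apply is_Os_integral_fresnel.
  - intros p Hp.
    assert (H : forall q : C,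
      ((exists j : nat, q = (- (p * RtoC (INR j)))%C) -> pole_of_order 1 (fun q' => gen_fresnel s p q') q) /\
      (~ (exists j : nat, q = (- (p * RtoC (INR j)))%C) ->
         holomorphic_at (fun q' => gen_fresnel s p q') q /\ gen_fresnel s p q <> RtoC 0)).
    { intros q; split; [intros [j ->]; now apply gen_fresnel_q_pole | now apply gen_fresnel_q_regular]. }
    split; [|exact H]; intros q _; destruct (H q) as [H1 H2].
    destruct (classic (exists j : nat, q = (- (p * RtoC (INR j)))%C)) as [E|E].
    + right; exists 1%nat; now apply H1.
    + left; now apply H2.
  - intros q.
    assert (H : forall p : C, p <> RtoC 0 ->
      ((exists j : nat, (1 <= j)%nat /\ p = (- (q / RtoC (INR j)))%C) ->
         pole_of_order 1 (fun p' => gen_fresnel s p' q) p) /\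
      (~ (exists j : nat, (1 <= j)%nat /\ p = (- (q / RtoC (INR j)))%C) ->
         holomorphic_at (fun p' => gen_fresnel s p' q) p)).
    { intros p Hp; split; [intros [j [Hj ->]]; now apply gen_fresnel_p_pole | now apply gen_fresnel_p_regular]. }
    split; [|exact H]; intros p Hp; destruct (H p Hp) as [H1 H2].
    destruct (classic (exists j : nat, (1 <= j)%nat /\ p = (- (q / RtoC (INR j)))%C)) as [E|E].
    + right; exists 1%nat; now apply H1.
    + left; now apply H2.
Qed.
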